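(* Let $y^*,y\in\{1,\dots,K\}$, $\mathbf c=\mathbf e_{y^*}-\mathbf e_y\in\mathbb R^K$, and consider the linear program $$(P)\qquad \min_{\tilde X,H^{(\cdot)},\hat H^{(\cdot)}} \mathbf c^\top \hat H^{(L)}\quad\text{subject to}\quad \tilde X\in\hat{\mathcal X}_{q,Q}(\dot X),\ [H^{(\cdot)},\hat H^{(\cdot)}]\in\mathcal Z_{q,Q}(\tilde X).$$ The linear programming dual of $(P)$ is equivalent (in the sense of having the same optimal value) to $$\max_{\Omega,\eta,\rho}\ g^t_{q,Q}(\dot X,\mathbf c,\Omega,\eta,\rho)\quad\text{subject to}\quad \Omega^{(l)}\in[0,1]^{|\mathcal N_{L-l}|\times h^{(l)}}\ (l=L-1,\dots,2),\quad \eta\in\mathbb R_{\ge0}^{|\mathcal N_{L-1}|},\quad \rho\in\mathbb R_{\ge0},$$ where $$g^t_{q,Q}(\dot X,\mathbf c,\Omega,\eta,\rho)=\sum_{l=2}^{L-1}\sum_{(n,j)\in\mathcal I^{(l)}}\frac{S^{(l)}_{nj}R^{(l)}_{nj}}{S^{(l)}_{nj}-R^{(l)}_{nj}}\big[\hat\Phi^{(l)}_{nj}\big]_+-\sum_{l=1}^{L-1}\mathbf 1^\top\Phi^{(l+1)}b^{(l)}-\operatorname{Tr}\big[\dot X^\top\hat\Phi^{(1)}\big]-\|\Psi\|_1-q\sum_{n}\eta_n-Q\rho,$$ and the remaining quantities are determined by $$\Phi^{(L)}=-\mathbf c\ \text{(as a row with $K$ entries)},\qquad \hat\Phi^{(l)}=\dot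 A^{(l)\top}\Phi^{(l+1)}W^{(l)\top}\in\mathbb R^{|\mathcal N_{L-l}|\times h^{(l)}}\quad(l=L-1,\dots,1),$$ $$\Phi^{(l)}_{nj}=\begin{cases}0&(n,j)\in\mathcal I^{(l)}_-\\ \hat\Phi^{(l)}_{nj}&(n,j)\in\mathcal I^{(l)}_+\\ \dfrac{S^{(l)}_{nj}}{S^{(l)}_{nj}-R^{(l)}_{nj}}\big[\hat\Phi^{(l)}_{nj}\big]_+-\Omega^{(l)}_{nj}\big[\hat\Phi^{(l)}_{nj}\big]_-&(n,j)\in\mathcal I^{(l)}\end{cases}\qquad(l=L-1,\dots,2),$$ $$\Psi_{nd}=\max\{\Delta_{nd}-(\eta_n+\rho),0\},\qquad \Delta_{nd}=\big[\hat\Phi^{(1)}_{nd}\big]_+(1-\dot X_{nd})+\big[\hat\Phi^{(1)}_{nd}\big]_-\dot X_{nd}.$$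
   Context: Notation: $[x]_+=\max(x,0)$ and $[x]_-=-\min(x,0)$; $\|\cdot\|_p$ of a matrix is the entry-wise norm. Setting. $G$ is a graph on $N$ nodes with binary node feature matrix $X\in\{0,1\}^{N\times D}$. A graph neural network with $L$ layers is given by real message passing matrices $\hat A^{(l)}\in\mathbb R^{N\times N}$ ($l=1,\dots,L-1$; entry $(u,v)$ is zero unless $v$ is $u$ itself or a neighbor of $u$), weights $W^{(l)}\in\mathbb R^{h^{(l)}\times h^{(l+1)}}$ and biases $b^{(l)}\in\mathbb R^{h^{(l+1)}}$ (added to every row; regarded as a column vector in products), with $h^{(1)}=D$, $h^{(L)}=K$ (number of classes). Fix a target node $t$. $\mathcal N_l(t)$ is the set of nodes reachable from $t$ in at most $l$ hops (including $t$); write $\mathcal N_l=\mathcal N_l(t)$. Slices: $\dot X=X_{\mathcal N_{L-1}:}$ (rows indexed by $\mathcal N_{L-1}$), and $\dot A^{(l)}=\hat A^{(l)}_{\mathcal N_{L-l-1},\mathcal N_{L-l}}$ (rows, columns) for $l=1,\dots,L-1$. Exact network. For an input $\tilde X$ with rows indexed by $\mathcal N_{L-1}$, put $H^{(1)}=\tilde X$, (i) $\hat H^{(l)}=\dot A^{(l-1)}H^{(l-1)}W^{(l-1)}+b^{(l-1)}$ for $l=2,\dots,L$, (ii) $H^{(l)}_{nj}=\max\{\hat H^{(l)}_{nj},0\}$ for $l=2,\dots,L-1$. $\hat H^{(L)}$ has a single row, regarded as a vector in $\mathbb R^K$. Perturbation sets, for budgets $q,Q\in\mathbb N$: $\mathcal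 X_{q,Q}(\dot X)$ is the set of $\tilde X$ with entries in $\{0,1\}$, $\|\tilde X-\dot X\|_0\le Q$, and $\|\tilde X_{n:}-\dot X_{n:}\|_0\le q$ for all $n\in\mathcal N_{L-1}$. $\hat{\mathcal X}_{q,Q}(\dot X)$ is the set of $\tilde X$ with entries in $[0,1]$, $\|\tilde X-\dot X\|_1\le Q$, and $\|\tilde X_{n:}-\dot X_{n:}\|_1\le q$ for all $n\in\mathcal N_{L-1}$. Activation bounds. For $l=2,\dots,L-1$ real matrices $R^{(l)},S^{(l)}$ are given that are lower/upper bounds on the ReLU inputs under the admissible perturbations: $R^{(l)}_{nj}\le\hat H^{(l)}_{nj}\le S^{(l)}_{nj}$ for the exact network applied to any $\tilde X\in\mathcal X_{q,Q}(\dot X)$. Let $\mathcal I^{(l)}$ be the set of $(n,j)$ with $R^{(l)}_{nj}<0<S^{(l)}_{nj}$, $\mathcal I_+^{(l)}$ those for which both bounds are nonnegative, $\mathcal I_-^{(l)}$ those for which both are nonpositive. Relaxed network. $\mathcal Z_{q,Q}(\tilde X)$ is the set of collections of real matrices $[H^{(\cdot)},\hat H^{(\cdot)}]$ with $H^{(1)}=\tilde X$ satisfying the linear equations (i) for $l=2,\dots,L$ and, for $l=2,\dots,L-1$: $H^{(l)}_{nj}=\hat H^{(l)}_{nj}$ if $(n,j)\in\mathcal I_+^{(l)}$; $H^{(l)}_{nj}=0$ if $(n,j)\in\mathcal I_-^{(l)}$; and if $(n,j)\in\mathcal I^{(l)}$: $H^{(l)}_{nj}\ge\hat H^{(l)}_{nj}$,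 $H^{(l)}_{nj}\ge0$, $H^{(l)}_{nj}(S^{(l)}_{nj}-R^{(l)}_{nj})\le S^{(l)}_{nj}(\hat H^{(l)}_{nj}-R^{(l)}_{nj})$.
   Formalization: For L≥4 the claim fails as stated; it is assumed in addition that for l≥3 the bounds R,S also hold at entries of I^(l) for the ReLU inputs of the relaxed network with inputs in the relaxed perturbation set. Entries with R=S=0 are placed in I_- only. *)

(* Defs.v *)
From HB Require Import structures.
From mathcomp Require Import all_boot all_order all_algebra.
From mathcomp Require Import reals.

Set Implicit Arguments.
Unset Strict Implicit.
Unset Printing Implicit Defensive.

Import Order.TTheory GRing.Theory Num.Theory.
Local Open Scope ring_scope.

Definition pos_part (R : realDomainType) (x : R) : R := Num.max x 0.
Definition neg_part (R : realDomainType) (x : R) : R := - Num.min x 0.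

Definition norm0 (R : realDomainType) m n (M : 'M[R]_(m, n)) : nat :=
  #|[set p : 'I_m * 'I_n | M p.1 p.2 != 0]|.
Definition norm1 (R : realDomainType) m n (M : 'M[R]_(m, n)) : R :=
  \sum_i \sum_j `|M i j|.

Definition is_max (R : realDomainType) (S : R -> Prop) (v : R) : Prop :=
  S v /\ forall w, S w -> w <= v.

(** Linear programs: minimise [cost . x] over free [x] subject to
    [geA x >= geb] and [eqA x = eqb]. *)
Record lin_prog (R : realDomainType) := LinProg {
  lp_var : finType;
  lp_ge : finType;
  lp_eq : finType;
  lp_cost : lp_var -> R;
  lp_geA : lp_ge -> lp_var -> R;
  lp_geb : lp_ge -> R;
  lp_eqA : lp_eq -> lp_var -> R;
  lp_eqb : lp_eq -> R }.

Section LinProg.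
Context (R : realDomainType) (P : lin_prog R).

Definition lp_value (x : lp_var P -> R) : R := \sum_v lp_cost v * x v.

Definition lp_feasible (x : lp_var P -> R) : Prop :=
  (forall i : lp_ge P, lp_geb i <= \sum_v lp_geA i v * x v) /\
  (forall e : lp_eq P, \sum_v lp_eqA e v * x v = lp_eqb e).

Definition lp_dual_feasible (y : lp_ge P -> R) (z : lp_eq P -> R) : Prop :=
  (forall i, 0 <= y i) /\
  (forall v : lp_var P,
     \sum_i y i * lp_geA i v + \sum_e z e * lp_eqA e v = lp_cost v).

Definition lp_dual_value (y : lp_ge P -> R) (z : lp_eq P -> R) : R :=
  \sum_i y i * lp_geb i + \sum_e z e * lp_eqb e.

Definition lp_dual_attains (w : R) : Prop :=
  exists y z, lp_dual_feasible y z /\ w = lp_dual_value y z.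

End LinProg.

(** Coefficient of the variable [v] in an affine function [f]. *)
Definition coef (R : realDomainType) (V : finType) (f : (V -> R) -> R) (v : V)
    : R :=
  f (fun u => (u == v)%:R) - f (fun=> 0).

(** The linear program: minimise [cost] (up to its constant term) subject to
    [ge i >= 0] and [eqn e = 0], all these functions being affine. *)
Definition lp_of_affine (R : realDomainType) (V I E : finType)
    (cost : (V -> R) -> R) (ge : I -> (V -> R) -> R) (eqn : E -> (V -> R) -> R)
    : lin_prog R :=
  @LinProg R V I E (coef cost)
    (fun i => coef (ge i)) (fun i => - ge i (fun=> 0))
    (fun e => coef (eqn e)) (fun e => - eqn e (fun=> 0)).

Section Affine.
Context (R : realDomainType) (V : finType).
Implicit Types (f g : (V -> R) -> R).

Definition is_affine f : Prop :=
  exists a0 a, forall x, f x = a0 + \sum_v a v * x v.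

Lemma affine_coef f : is_affine f ->
  forall x, \sum_v coef f v * x v = f x - f (fun=> 0).
Proof.
move=> [a0 [a fE]] x.
have f0 : f (fun=> 0) = a0.
  by rewrite fE big1 ?addr0 // => v _; rewrite mulr0.
rewrite f0 fE [a0 + _]addrC addrK; apply: eq_bigr => v _; congr (_ * _).
rewrite /coef f0 fE [a0 + _]addrC addrK (bigD1 v) //= eqxx mulr1.
by rewrite big1 ?addr0 // => u /negPf ->; rewrite mulr0.
Qed.

Lemma affine_ext f g : f =1 g -> is_affine f -> is_affine g.
Proof. by move=> fg [a0 [a fE]]; exists a0, a => x; rewrite -fg. Qed.

Lemma affine_cst k : is_affine (fun=> k).
Proof.
exists k, (fun=> 0) => x; rewrite big1 ?addr0 // => v _; exact: mul0r.
Qed.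

Lemma affine_var u : is_affine (fun x => x u).
Proof.
exists 0, (fun v => (v == u)%:R) => x; rewrite add0r (bigD1 u) //= eqxx mul1r.
by rewrite big1 ?addr0 // => v /negPf ->; rewrite mul0r.
Qed.

Lemma affineD f g : is_affine f -> is_affine g ->
  is_affine (fun x => f x + g x).
Proof.
move=> [a0 [a fE]] [b0 [b gE]]; exists (a0 + b0), (fun v => a v + b v) => x.
rewrite fE gE addrACA -big_split; congr (_ + _).
by apply: eq_bigr => v _; rewrite mulrDl.
Qed.

Lemma affineMl k f : is_affine f -> is_affine (fun x => k * f x).
Proof.
move=> [a0 [a fE]]; exists (k * a0), (fun v => k * a v) => x.
rewrite fE mulrDr mulr_sumr; congr (_ + _).
by apply: eq_bigr => v _; rewrite mulrA.
Qed.

Lemma affineMr k f : is_affine f -> is_affine (fun x => f x * k).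
Proof.
by move=> /(affineMl k); apply: affine_ext => x; rewrite mulrC.
Qed.

Lemma affineN f : is_affine f -> is_affine (fun x => - f x).
Proof.
by move=> /(affineMl (-1)); apply: affine_ext => x; rewrite mulN1r.
Qed.

Lemma affineB f g : is_affine f -> is_affine g ->
  is_affine (fun x => f x - g x).
Proof. by move=> ? ?; apply: affineD => //; apply: affineN. Qed.

Lemma affine_sum (I : finType) (F : I -> (V -> R) -> R) :
  (forall i, is_affine (F i)) -> is_affine (fun x => \sum_i F i x).
Proof.
move=> FA; elim: (index_enum I) => [|i s IH].
  by apply: (affine_ext _ (affine_cst 0)) => x; rewrite big_nil.
by apply: (affine_ext _ (affineD (FA i) IH)) => x; rewrite big_cons.
Qed.

Lemma affine_if (b : bool) f g : is_affine f -> is_affine g ->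
  is_affine (fun x => if b then f x else g x).
Proof. by case: b. Qed.

Lemma lp_of_affine_feasible (I E : finType) cost
    (ge : I -> (V -> R) -> R) (eqn : E -> (V -> R) -> R) :
  (forall i, is_affine (ge i)) -> (forall e, is_affine (eqn e)) ->
  forall x : V -> R, lp_feasible (P := lp_of_affine cost ge eqn) x <->
    (forall i, 0 <= ge i x) /\ (forall e, eqn e x = 0).
Proof.
move=> geA eqA x; split=> -[hge heq]; split=> [i|e] /=.
- by have := hge i; rewrite /= affine_coef // lerBrDr addNr.
- by have /= := heq e; rewrite affine_coef // -[RHS]sub0r => /addIr.
- by rewrite affine_coef // lerBrDr addNr; apply: hge.
- by rewrite affine_coef // heq sub0r.
Qed.

End Affine.

(** [adj u v] means that [v] is a neighbor of [u]. *)
Fixpoint ball N (adj : rel 'I_N) (t : 'I_N) (l : nat) : {set 'I_N} :=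
  if l is k.+1 then
    ball adj t k :|: [set v | [exists u in ball adj t k, adj u v]]
  else [set t].

Lemma target_in_ball N (adj : rel 'I_N) (t : 'I_N) l : t \in ball adj t l.
Proof. by elim: l => [|l IH] /=; rewrite ?inE ?eqxx ?IH. Qed.

Section Network.
Context (R : realType) (N : nat) (adj : rel 'I_N) (t : 'I_N).
Context (L : nat) (h : nat -> nat).

(** The rows of the layer-[l] matrices. *)
Definition nodes (l : nat) : {set 'I_N} := ball adj t (L - l).

(** Families of layer matrices are total in [l : nat]; only the layers named
    in the constraints below are meaningful. *)
Definition layers := forall l : nat, 'M[R]_(#|nodes l|, h l).

Context (A : nat -> 'M[R]_N).
Context (W : forall l : nat, 'M[R]_(h l, h l.+1)).
Context (b : forall l : nat, 'cV[R]_(h l.+1)).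
Context (X : 'M[R]_(N, h 1%N)).
Context (q Q : nat).
Context (Rb Sb : layers).

Definition Adot (l : nat) : 'M[R]_(#|nodes l.+1|, #|nodes l|) :=
  mxsub enum_val enum_val (A l).

Definition Xdot : 'M[R]_(#|nodes 1%N|, h 1%N) := rowsub enum_val X.

Definition bias_rows (l : nat) : 'M[R]_(#|nodes l.+1|, h l.+1) :=
  \matrix_(n, j) b l j 0.

Definition linear_step (H Hh : layers) (l : nat) : Prop :=
  Hh l.+1 = Adot l *m H l *m W l + bias_rows l.

Definition exact_network (Xt : 'M[R]_(#|nodes 1%N|, h 1%N)) (H Hh : layers) :=
  [/\ H 1%N = Xt,
      forall l, (1 <= l < L)%N -> linear_step H Hh l
    & forall l, (2 <= l < L)%N ->
        forall n j, H l n j = Num.max (Hh l n j) 0].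

Definition binary_perturbation (Xt : 'M[R]_(#|nodes 1%N|, h 1%N)) : Prop :=
  [/\ forall n d, Xt n d = 0 \/ Xt n d = 1,
      (norm0 (Xt - Xdot) <= Q)%N
    & forall n, (norm0 (row n (Xt - Xdot)) <= q)%N].

Definition relaxed_perturbation (Xt : 'M[R]_(#|nodes 1%N|, h 1%N)) : Prop :=
  [/\ forall n d, 0 <= Xt n d <= 1,
      norm1 (Xt - Xdot) <= Q%:R
    & forall n, norm1 (row n (Xt - Xdot)) <= q%:R].

Definition Iunst (l : nat) : {set 'I_#|nodes l| * 'I_(h l)} :=
  [set p | Rb l p.1 p.2 < 0 < Sb l p.1 p.2].
Definition Iminus (l : nat) : {set 'I_#|nodes l| * 'I_(h l)} :=
  [set p | (Rb l p.1 p.2 <= 0) && (Sb l p.1 p.2 <= 0)].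
(** The three sets have to be disjoint: an entry both of whose bounds are [0]
    meets both sign conditions and is put in [Iminus]. *)
Definition Iplus (l : nat) : {set 'I_#|nodes l| * 'I_(h l)} :=
  [set p | (0 <= Rb l p.1 p.2) && (0 <= Sb l p.1 p.2)] :\: Iminus l.

Definition relaxed_relu (H Hh : layers) (l : nat) : Prop :=
  forall n j,
  [/\ (n, j) \in Iplus l -> H l n j = Hh l n j,
      (n, j) \in Iminus l -> H l n j = 0
    & (n, j) \in Iunst l ->
        [/\ H l n j >= Hh l n j,
            H l n j >= 0
          & H l n j * (Sb l n j - Rb l n j)
              <= Sb l n j * (Hh l n j - Rb l n j)]].

(** The part of the relaxed network that determines the layers [l < m] and the
    ReLU inputs [Hh m]. *)
Definition relaxed_upto (m : nat) (Xt : 'M[R]_(#|nodes 1%N|, h 1%N))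
    (H Hh : layers) : Prop :=
  [/\ H 1%N = Xt,
      forall l, (1 <= l < m)%N -> linear_step H Hh l
    & forall l, (2 <= l < m)%N -> relaxed_relu H Hh l].

Definition relaxed_network := relaxed_upto L.

Definition valid_bounds : Prop :=
  forall Xt H Hh, binary_perturbation Xt -> exact_network Xt H Hh ->
  forall l, (2 <= l < L)%N ->
  forall n j, Rb l n j <= Hh l n j <= Sb l n j.

(** From the second hidden layer on, [valid_bounds] does not bound the ReLU
    inputs of the relaxed network, whereas the three inequalities of
    [relaxed_relu] force [Rb <= Hh <= Sb]; the dual objective [dual_obj] does
    not see these implied constraints, and without the present condition its
    maximum can be smaller than the value of the linear program.
    Example: one node, [L = 4], scalar input [0], [q = Q = 1],
    hidden inputs [x - 1/2] and [1/2 - x] with bounds [-1/2, 1/2],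
    then [a + b - 6/10] with bounds [-1/10, 4/10] and [a + b] with bounds
    [1/4, 3/4], output [a + b] of the latter against [0]: the linear program
    has value [1/2] and [dual_obj] has maximum [0].
    In the first hidden layer [valid_bounds] suffices, so that this condition
    is void for [L <= 3]. *)
Definition relaxation_within_bounds : Prop :=
  forall l, (3 <= l < L)%N ->
  forall Xt H Hh, relaxed_perturbation Xt -> relaxed_upto l Xt H Hh ->
  forall n j, (n, j) \in Iunst l -> Rb l n j <= Hh l n j <= Sb l n j.

Context (c : 'cV[R]_(h L)).

(** The row of the target node; it is the only row of [Hh L]. *)
Definition target_row : 'I_#|nodes L| :=
  enum_rank_in (target_in_ball adj t (L - L)) t.

Definition objective (Hh : layers) : R := (Hh L *m c) target_row 0.

(** The variables of the linear program are the entries of [Xt], of [H l] for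
    [1 <= l <= L - 1] ([l = i.+1]) and of [Hh l] for [2 <= l <= L]
    ([l = i.+2]). *)
Definition pvar : finType :=
  ('I_#|nodes 1%N| * 'I_(h 1%N)
   + {i : 'I_L.-1 & ('I_#|nodes i.+1| * 'I_(h i.+1))%type}
   + {i : 'I_L.-1 & ('I_#|nodes i.+2| * 'I_(h i.+2))%type})%type.

Definition Xt_of (x : pvar -> R) : 'M[R]_(#|nodes 1%N|, h 1%N) :=
  \matrix_(n, d) x (inl (inl (n, d))).

Definition H_of (x : pvar -> R) : layers := fun l =>
  match l with
  | i.+1 =>
    match @idP (i < L.-1)%N with
    | ReflectT lt_i => \matrix_(n, j)
        x (inl (inr (existT _ (Ordinal lt_i) (n, j))))
    | ReflectF _ => 0
    end
  | 0 => 0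
  end.

Definition Hh_of (x : pvar -> R) : layers := fun l =>
  match l with
  | i.+2 =>
    match @idP (i < L.-1)%N with
    | ReflectT lt_i => \matrix_(n, j) x (inr (existT _ (Ordinal lt_i) (n, j)))
    | ReflectF _ => 0
    end
  | _ => 0
  end.

(** For a binary [Xdot] and entries of [Xt] in [0, 1], this is
    [`|Xt n d - Xdot n d|]. *)
Definition deviation (Xt : 'M[R]_(#|nodes 1%N|, h 1%N)) n d : R :=
  (1 - Xdot n d) * Xt n d + Xdot n d * (1 - Xt n d).

Definition relu_index : finType :=
  {k : 'I_L.-2 & ('I_#|nodes k.+2| * 'I_(h k.+2))%type}.

Inductive pineq :=
  | X_ge0 of 'I_#|nodes 1%N| * 'I_(h 1%N)
  | X_le1 of 'I_#|nodes 1%N| * 'I_(h 1%N)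
  | RowBudget of 'I_#|nodes 1%N|
  | TotalBudget
  | ReluGeInput of relu_index
  | ReluGe0 of relu_index
  | ReluLeChord of relu_index.

Inductive peqn :=
  | InputEq of 'I_#|nodes 1%N| * 'I_(h 1%N)
  | LinearEq of {i : 'I_L.-1 & ('I_#|nodes i.+2| * 'I_(h i.+2))%type}
  | ReluActive of relu_index
  | ReluInactive of relu_index.

Definition pineq_code (i : pineq) :
    ('I_#|nodes 1%N| * 'I_(h 1%N)) + ('I_#|nodes 1%N| * 'I_(h 1%N))
    + ('I_#|nodes 1%N| + unit) + (relu_index + relu_index + relu_index) :=
  match i with
  | X_ge0 p => inl (inl (inl p))
  | X_le1 p => inl (inl (inr p))
  | RowBudget n => inl (inr (inl n))
  | TotalBudget => inl (inr (inr tt))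
  | ReluGeInput k => inr (inl (inl k))
  | ReluGe0 k => inr (inl (inr k))
  | ReluLeChord k => inr (inr k)
  end.

Definition pineq_decode i : pineq :=
  match i with
  | inl (inl (inl p)) => X_ge0 p
  | inl (inl (inr p)) => X_le1 p
  | inl (inr (inl n)) => RowBudget n
  | inl (inr (inr tt)) => TotalBudget
  | inr (inl (inl k)) => ReluGeInput k
  | inr (inl (inr k)) => ReluGe0 k
  | inr (inr k) => ReluLeChord k
  end.

Lemma pineq_codeK : cancel pineq_code pineq_decode. Proof. by case. Qed.
HB.instance Definition _ := Finite.copy pineq (can_type pineq_codeK).

Definition peqn_code (e : peqn) :
    ('I_#|nodes 1%N| * 'I_(h 1%N))
    + {i : 'I_L.-1 & ('I_#|nodes i.+2| * 'I_(h i.+2))%type}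
    + (relu_index + relu_index) :=
  match e with
  | InputEq p => inl (inl p)
  | LinearEq p => inl (inr p)
  | ReluActive k => inr (inl k)
  | ReluInactive k => inr (inr k)
  end.

Definition peqn_decode e : peqn :=
  match e with
  | inl (inl p) => InputEq p
  | inl (inr p) => LinearEq p
  | inr (inl k) => ReluActive k
  | inr (inr k) => ReluInactive k
  end.

Lemma peqn_codeK : cancel peqn_code peqn_decode. Proof. by case. Qed.
HB.instance Definition _ := Finite.copy peqn (can_type peqn_codeK).

(** The constraints are [pineq_fun i x >= 0] and [peqn_fun e x = 0]; those
    attached to an entry outside the relevant index set are [0 >= 0], resp.
    [0 = 0]. *)
Definition pineq_fun (i : pineq) (x : pvar -> R) : R :=
  let Xt := Xt_of x in let H := H_of x in let Hh := Hh_of x in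
  match i with
  | X_ge0 (n, d) => Xt n d
  | X_le1 (n, d) => 1 - Xt n d
  | RowBudget n => q%:R - \sum_d deviation Xt n d
  | TotalBudget => Q%:R - \sum_n \sum_d deviation Xt n d
  | ReluGeInput (existT k (n, j)) =>
      if (n, j) \in Iunst k.+2 then H k.+2 n j - Hh k.+2 n j else 0
  | ReluGe0 (existT k (n, j)) =>
      if (n, j) \in Iunst k.+2 then H k.+2 n j else 0
  | ReluLeChord (existT k (n, j)) =>
      if (n, j) \in Iunst k.+2 then
        Sb k.+2 n j * (Hh k.+2 n j - Rb k.+2 n j)
        - H k.+2 n j * (Sb k.+2 n j - Rb k.+2 n j)
      else 0
  end.

Definition peqn_fun (e : peqn) (x : pvar -> R) : R :=
  let Xt := Xt_of x in let H := H_of x in let Hh := Hh_of x in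
  match e with
  | InputEq (n, d) => H 1%N n d - Xt n d
  | LinearEq (existT i (n, j)) =>
      (Hh i.+2 - (Adot i.+1 *m H i.+1 *m W i.+1 + bias_rows i.+1)) n j
  | ReluActive (existT k (n, j)) =>
      if (n, j) \in Iplus k.+2 then H k.+2 n j - Hh k.+2 n j else 0
  | ReluInactive (existT k (n, j)) =>
      if (n, j) \in Iminus k.+2 then H k.+2 n j else 0
  end.

(** This is the problem of minimising [objective Hh] subject to
    [relaxed_perturbation Xt] and [relaxed_network Xt H Hh]: see
    [primal_lp_feasible], [primal_lp_value] and [primal_lp_surj]. *)
Definition primal_lp : lin_prog R :=
  lp_of_affine (fun x => objective (Hh_of x)) pineq_fun peqn_fun.

Lemma affine_Xt n d : is_affine (fun x => Xt_of x n d).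
Proof.
by apply: (affine_ext _ (affine_var _ (inl (inl (n, d))))) => x; rewrite mxE.
Qed.

Lemma affine_H l n j : is_affine (fun x => H_of x l n j).
Proof.
case: l n j => [|i] n j; rewrite /H_of; first exact: affine_cst.
case: {-}_ / idP => [p|_]; last exact: affine_cst.
apply: affine_ext (affine_var _ (inl (inr (existT _ (Ordinal p) (n, j))))) => x.
by rewrite mxE.
Qed.

Lemma affine_Hh l n j : is_affine (fun x => Hh_of x l n j).
Proof.
case: l n j => [|[|i]] n j; rewrite /Hh_of; try exact: affine_cst.
case: {-}_ / idP => [p|_]; last exact: affine_cst.
apply: affine_ext (affine_var _ (inr (existT _ (Ordinal p) (n, j)))) => x.
by rewrite mxE.
Qed.

Lemma affine_deviation n d : is_affine (fun x => deviation (Xt_of x) n d).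
Proof.
apply: affineD; apply: affineMl; first exact: affine_Xt.
by apply: affineB; [exact: affine_cst | exact: affine_Xt].
Qed.

Lemma affine_objective : is_affine (fun x => objective (Hh_of x)).
Proof.
apply: (@affine_ext _ _
  (fun x => \sum_k Hh_of x L target_row k * c k 0)) => [x|].
  by rewrite /objective mxE.
by apply: affine_sum => k; apply: affineMr; apply: affine_Hh.
Qed.

Lemma affine_pineq i : is_affine (pineq_fun i).
Proof.
case: i => [[n d]|[n d]|n||[k [n j]]|[k [n j]]|[k [n j]]] /=.
- exact: affine_Xt.
- by apply: affineB; [exact: affine_cst | exact: affine_Xt].
- apply: affineB; [exact: affine_cst | apply: affine_sum => d].
  exact: affine_deviation.
- apply: affineB; [exact: affine_cst | apply: affine_sum => n].
  by apply: affine_sum => d; apply: affine_deviation.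
- apply: affine_if; last exact: affine_cst.
  by apply: affineB; [exact: affine_H | exact: affine_Hh].
- by apply: affine_if; [exact: affine_H | exact: affine_cst].
- apply: affine_if; last exact: affine_cst.
  apply: affineB; last by apply: affineMr; apply: affine_H.
  by apply: affineMl; apply: affineB; [exact: affine_Hh | exact: affine_cst].
Qed.

Lemma affine_peqn e : is_affine (peqn_fun e).
Proof.
case: e => [[n d]|[i [n j]]|[k [n j]]|[k [n j]]].
- by apply: affineB; [exact: affine_H | exact: affine_Xt].
- pose g x := Hh_of x i.+2 n j - (\sum_k (\sum_m Adot i.+1 n m
    * H_of x i.+1 m k) * W i.+1 k j + b i.+1 j 0).
  apply: (@affine_ext _ _ g) => [x|].
    rewrite /g /peqn_fun 4!mxE [in RHS]mxE; congr (_ - (_ + _)).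
    by apply: eq_bigr => k _; rewrite mxE.
  apply: affineB; first exact: affine_Hh.
  apply: affineD; last exact: affine_cst.
  apply: affine_sum => k; apply: affineMr; apply: affine_sum => m.
  by apply: affineMl; apply: affine_H.
- apply: affine_if; last exact: affine_cst.
  by apply: affineB; [exact: affine_H | exact: affine_Hh].
- by apply: affine_if; [exact: affine_H | exact: affine_cst].
Qed.

Lemma deviationE (Xt : 'M[R]_(#|nodes 1%N|, h 1%N)) n d :
  (forall u k, X u k = 0 \/ X u k = 1) ->
  0 <= Xt n d <= 1 -> deviation Xt n d = `|(Xt - Xdot) n d|.
Proof.
move=> Xbin /andP[Xge0 Xle1]; rewrite /deviation !mxE.
case: (Xbin (enum_val n) d) => ->.
  by rewrite !subr0 mul1r mul0r addr0 ger0_norm.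
by rewrite subrr mul0r add0r mul1r distrC ger0_norm // subr_ge0.
Qed.

Lemma primal_lp_feasible (x : pvar -> R) :
  (forall u d, X u d = 0 \/ X u d = 1) ->
  lp_feasible (P := primal_lp) x <->
  relaxed_perturbation (Xt_of x) /\
  relaxed_network (Xt_of x) (H_of x) (Hh_of x).
Proof.
move=> Xbin.
have rowE n (Xt : 'M[R]_(#|nodes 1%N|, h 1%N)) : (forall d, 0 <= Xt n d <= 1) ->
    norm1 (row n (Xt - Xdot)) = \sum_d deviation Xt n d.
  move=> Xt01; rewrite /norm1 big_ord1; apply: eq_bigr => d _.
  by rewrite deviationE // mxE.
have allE (Xt : 'M[R]_(#|nodes 1%N|, h 1%N)) : (forall n d, 0 <= Xt n d <= 1) ->
    norm1 (Xt - Xdot) = \sum_n \sum_d deviation Xt n d.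
  move=> Xt01; apply: eq_bigr => n _; apply: eq_bigr => d _.
  by rewrite deviationE.
rewrite (lp_of_affine_feasible _ affine_pineq affine_peqn); split.
  move=> [hge heq].
  have Xt01 n d : 0 <= Xt_of x n d <= 1.
    by rewrite (hge (X_ge0 (n, d))) -subr_ge0 (hge (X_le1 (n, d))).
  split; first split=> // [|n].
  - by rewrite allE // -subr_ge0 (hge TotalBudget).
  - by rewrite rowE // -subr_ge0 (hge (RowBudget n)).
  split.
  - by apply/matrixP => n d; apply/subr0_eq; have := heq (InputEq (n, d)).
  - case=> // i /= iL; have {}iL : (i < L.-1)%N by rewrite ltn_predRL.
    apply/matrixP => n j; apply/subr0_eq.
    by have := heq (LinearEq (existT _ (Ordinal iL) (n, j))); rewrite /= 2!mxE.
  - case=> [|[|k]] //= kL; have {}kL : (k < L.-2)%N by rewrite !ltn_predRL.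
    move=> n j; pose r : relu_index := existT _ (Ordinal kL) (n, j).
    split=> hI.
    + by apply/subr0_eq; have := heq (ReluActive r); rewrite /= hI.
    + by have := heq (ReluInactive r); rewrite /= hI.
    + split.
      * by rewrite -subr_ge0; have := hge (ReluGeInput r); rewrite /= hI.
      * by have := hge (ReluGe0 r); rewrite /= hI.
      * by rewrite -subr_ge0; have := hge (ReluLeChord r); rewrite /= hI.
move=> [[Xt01 XtQ Xtq] [inE linE reluE]].
have reluP (k : 'I_L.-2) : relaxed_relu (H_of x) (Hh_of x) k.+2.
  by apply: reluE; rewrite /= -!ltn_predRL.
split.
  case=> [[n d]|[n d]|n||[k [n j]]|[k [n j]]|[k [n j]]] /=.
  - by case/andP: (Xt01 n d).
  - by rewrite subr_ge0; case/andP: (Xt01 n d).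
  - by rewrite subr_ge0 -rowE.
  - by rewrite subr_ge0 -allE.
  - by case: ifP => // hI; case: (reluP k n j) => _ _ /(_ hI)[];
    rewrite subr_ge0.
  - by case: ifP => // hI; case: (reluP k n j) => _ _ /(_ hI)[].
  - by case: ifP => // hI; case: (reluP k n j) => _ _ /(_ hI)[];
    rewrite subr_ge0.
case=> [[n d]|[i [n j]]|[k [n j]]|[k [n j]]].
- by rewrite /= -/(H_of x 1%N) inE subrr.
- rewrite /peqn_fun -(linE i.+1) ?subrr ?mxE //=.
  by rewrite -ltn_predRL.
- rewrite /peqn_fun; case: ifP => // hI.
  by case: (reluP k n j) => /(_ hI) -> _ _; rewrite subrr.
- rewrite /peqn_fun; case: ifP => // hI.
  by case: (reluP k n j) => _ /(_ hI) -> _.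
Qed.

Lemma primal_lp_value (x : pvar -> R) :
  lp_value (P := primal_lp) x = objective (Hh_of x).
Proof.
rewrite /lp_value (affine_coef affine_objective).
suff -> : objective (Hh_of (fun=> 0)) = 0 by rewrite subr0.
rewrite /objective (_ : Hh_of _ L = 0) ?mul0mx ?mxE //.
apply/matrixP => n j; rewrite mxE.
move: (L) n j => [|[|i]] n j; rewrite /Hh_of ?mxE //.
by case: {-}_ / idP => [p|_]; rewrite mxE.
Qed.

Lemma primal_lp_surj (Xt : 'M[R]_(#|nodes 1%N|, h 1%N)) (H Hh : layers) :
  exists x : pvar -> R,
  [/\ Xt_of x = Xt,
      forall l, (1 <= l < L)%N -> H_of x l = H l
    & forall l, (2 <= l <= L)%N -> Hh_of x l = Hh l].
Proof.
exists (fun v : pvar => match v with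
  | inl (inl (n, d)) => Xt n d
  | inl (inr (existT i (n, j))) => H i.+1 n j
  | inr (existT i (n, j)) => Hh i.+2 n j
  end); split.
- by apply/matrixP => n d; rewrite mxE.
- case=> // i /= iL; rewrite /H_of.
  case: {-}_ / idP => [p|]; last by rewrite ltn_predRL.
  by apply/matrixP => n j; rewrite mxE.
- case=> [|[|i]] //= iL; rewrite /Hh_of.
  case: {-}_ / idP => [p|]; last by rewrite ltn_predRL.
  by apply/matrixP => n j; rewrite mxE.
Qed.


Definition Delta (Phih1 : 'M[R]_(#|nodes 1%N|, h 1%N)) :
    'M[R]_(#|nodes 1%N|, h 1%N) :=
  \matrix_(n, d) (pos_part (Phih1 n d) * (1 - Xdot n d)
                  + neg_part (Phih1 n d) * Xdot n d).

Definition Psi (Phih1 : 'M[R]_(#|nodes 1%N|, h 1%N))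
    (eta : 'cV[R]_#|nodes 1%N|) (rho : R) : 'M[R]_(#|nodes 1%N|, h 1%N) :=
  \matrix_(n, d) Num.max (Delta Phih1 n d - (eta n 0 + rho)) 0.

(** The equations that determine [Phi l] for [2 <= l <= L] and [Phih l] for
    [1 <= l <= L - 1] by downward recursion from [Omega]. *)
Definition dual_network (Omega Phi Phih : layers) : Prop :=
  [/\ Phi L = \matrix_(n, k) - c k 0,
      forall l, (1 <= l < L)%N ->
        Phih l = (Adot l)^T *m Phi l.+1 *m (W l)^T
    & forall l, (2 <= l < L)%N -> forall n j,
      [/\ (n, j) \in Iminus l -> Phi l n j = 0,
          (n, j) \in Iplus l -> Phi l n j = Phih l n j
        & (n, j) \in Iunst l ->
            Phi l n j =
              Sb l n j / (Sb l n j - Rb l n j) * pos_part (Phih l n j)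
              - Omega l n j * neg_part (Phih l n j)]].

Definition dual_obj (Phi Phih : layers) (eta : 'cV[R]_#|nodes 1%N|) (rho : R)
    : R :=
  \sum_(2 <= l < L) \sum_(p in Iunst l)
      Sb l p.1 p.2 * Rb l p.1 p.2 / (Sb l p.1 p.2 - Rb l p.1 p.2)
        * pos_part (Phih l p.1 p.2)
  - \sum_(1 <= l < L) (const_mx 1 *m Phi l.+1 *m b l : 'M[R]_1) 0 0
  - \tr (Xdot^T *m Phih 1%N)
  - norm1 (Psi (Phih 1%N) eta rho)
  - q%:R * \sum_n eta n 0
  - Q%:R * rho.

(** [w] is the value of the dual objective at a feasible
    [(Omega, eta, rho)]. *)
Definition dual_obj_attains (w : R) : Prop :=
  exists (Omega : layers) (eta : 'cV[R]_#|nodes 1%N|) (rho : R),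
  [/\ forall l, (2 <= l < L)%N -> forall n j, 0 <= Omega l n j <= 1,
      forall n, 0 <= eta n 0,
      0 <= rho
    & exists Phi Phih : layers,
        dual_network Omega Phi Phih /\ w = dual_obj Phi Phih eta rho].

End Network.

(* Main.v *)
(** Weak duality is a Lagrangian identity: a solution of the dual network gives
    multipliers for the constraints of the linear program, so every value of
    the dual objective is attained by the linear programming dual, hence is a
    lower bound for the relaxed network.

    For the converse, a lower bound for [- Phi . Hh] at layer [l + 1] is pulled
    back to layer [l].  Each hidden value is minimised out separately: on the
    chord if its coefficient is nonnegative, otherwise at [max (x, 0)], which is
    where [Rb <= x <= Sb] is needed.  A minimax argument over the convex set of
    reachable [x] replaces [w max (x, 0)] by some [Omega w x].  At the input
    layer a greedy choice of the flipped bits is optimal, with threshold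
    multipliers [eta] and [rho]; that the choice is binary also transfers the
    bounds on the first hidden layer to the relaxed perturbations.  The dual
    point so obtained dominates every lower bound of the primal. *)

Require Import Defs.
From mathcomp Require Import boolp classical_sets.
From mathcomp Require Import all_boot all_order all_algebra.
From mathcomp Require Import reals.
From mathcomp Require Import ring lra.

Set Implicit Arguments.
Unset Strict Implicit.
Unset Printing Implicit Defensive.

Import Order.TTheory GRing.Theory Num.Theory.
Local Open Scope ring_scope.

(** * Minimax *)

Section Minimax.
Context (R : realType) (E : lmodType R) (P : E -> Prop).

Definition convex_dom : Prop := forall x y (a b : R),
  P x -> P y -> 0 <= a -> 0 <= b -> a + b = 1 -> P (a *: x + b *: y).

Definition convex_fun (f : E -> R) : Prop := forall x y (a b : R),
  P x -> P y -> 0 <= a -> 0 <= b -> a + b = 1 ->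
  f (a *: x + b *: y) <= a * f x + b * f y.

Definition affine_fun (g : E -> R) : Prop := forall x y (a b : R),
  a + b = 1 -> g (a *: x + b *: y) = a * g x + b * g y.

Lemma affine_convex g : affine_fun g -> convex_fun g.
Proof. by move=> gA x y a b _ _ _ _ ab; rewrite gA. Qed.

Lemma affine_fun_scale k g : affine_fun g -> affine_fun (fun x => k * g x).
Proof. by move=> gA x y a b ab; rewrite gA //; ring. Qed.

Lemma convex_add f g :
  convex_fun f -> convex_fun g -> convex_fun (fun x => f x + g x).
Proof.
move=> fC gC x y a b Px Py a0 b0 ab.
have := fC x y a b Px Py a0 b0 ab; have := gC x y a b Px Py a0 b0 ab.
lra.
Qed.

Lemma convex_pos_part g :
  affine_fun g -> convex_fun (fun x => Num.max (g x) 0).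
Proof.
move=> gA x y a b _ _ a0 b0 ab; rewrite gA // ge_max; apply/andP; split.
  by apply: lerD; apply: ler_wpM2l => //; rewrite le_max lexx.
by apply: addr_ge0; apply: mulr_ge0 => //; rewrite le_max lexx orbT.
Qed.

Lemma affine_fun_sum (T : Type) (s : seq T) (g : T -> E -> R) :
  (forall t, affine_fun (g t)) -> affine_fun (fun x => \sum_(i <- s) g i x).
Proof.
move=> gA x y a b ab; rewrite !mulr_sumr -big_split.
by apply: eq_bigr => t _; rewrite gA.
Qed.

Hypothesis Pconv : convex_dom.

(* [om] is any number between the slopes [- F x / g x] with [g x > 0] and those
   with [g x < 0], where [F = f - inf (f + max g 0)]; a pair of points in the
   wrong order is excluded by the point of the segment between them at which
   [g] vanishes. *)
Lemma max0_minimax (f g : E -> R) : convex_fun f -> affine_fun g ->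
  exists2 om : R, 0 <= om <= 1 &
    forall v, (forall x, P x -> v <= f x + Num.max (g x) 0) ->
              forall x, P x -> v <= f x + om * g x.
Proof.
move=> fC gA.
(* If no [v] satisfies the premise, or if [P] is empty, any [om] will do. *)
have [[v0 v0P]|nobd] := pselect (exists v0, forall x, P x ->
    v0 <= f x + Num.max (g x) 0); last first.
  by exists 0 => [|v vP]; [rewrite lexx ler01 | case: nobd; exists v].
have [[x0 Px0]|noP] := pselect (exists x, P x); last first.
  by exists 0 => [|v vP x Px]; [rewrite lexx ler01 | case: noP; exists x].
pose V := [set f x + Num.max (g x) 0 | x in [set x | P x]]%classic.
have Vlb : has_lbound V by exists v0 => _ [x Px <-]; exact: v0P.
have V0 : nonempty V by exists (f x0 + Num.max (g x0) 0), x0.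
pose m := inf V.
have mP x : P x -> m <= f x + Num.max (g x) 0.
  by move=> Px; apply: (inf_lbound Vlb); exists x.
have vm v : (forall x, P x -> v <= f x + Num.max (g x) 0) -> v <= m.
  by move=> vP; apply: lb_le_inf => // _ [x Px <-]; exact: vP.
suff [om om01 omP] : exists2 om : R, 0 <= om <= 1 &
    forall x, P x -> m <= f x + om * g x.
  by exists om => // v /vm vlem x Px; apply: (le_trans vlem); apply: omP.
(* [0] is put in with the slopes so that the supremum is nonnegative and exists even if [g] is
   nowhere positive. *)
pose U := [set u | u = 0 \/
  exists2 x, P x & 0 < g x /\ u * g x = m - f x]%classic.
have U0 : nonempty U by exists 0; left.
have Uub : ubound U 1.
  move=> u [->|[x Px [gx ux]]]; first exact: ler01.
  rewrite -(ler_pM2r gx) ux mul1r lerBlDl.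
  by have := mP x Px; rewrite (max_l (ltW gx)).
have Uhas : has_ubound U by exists 1.
have mid y x : P y -> P x -> 0 < g y -> g x < 0 ->
    m * (g y - g x) <= - g x * f y + g y * f x.
  move=> Py Px gy gx.
  have d0 : 0 < g y - g x by lra.
  have dn : g y - g x != 0 by rewrite gt_eqF.
  pose a := - g x / (g y - g x); pose b := g y / (g y - g x).
  have a0 : 0 <= a by apply: divr_ge0; lra.
  have b0 : 0 <= b by apply: divr_ge0; lra.
  have ab : a + b = 1 by rewrite /a /b; field.
  have := mP _ (Pconv Py Px a0 b0 ab).
  have -> : g (a *: y + b *: x) = 0 by rewrite gA // /a /b; field.
  rewrite maxxx addr0 => /le_trans /(_ (fC _ _ _ _ Py Px a0 b0 ab)).
  rewrite -(ler_pM2r d0) => /le_trans; apply.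
  by rewrite (_ : (_ + _) * _ = - g x * f y + g y * f x) // /a /b; field.
exists (sup U).
  apply/andP; split; last exact: ge_sup.
  by apply: (ub_le_sup Uhas); left.
move=> x Px.
have [gx|gx|gx] := ltgtP (g x) 0; last first.
- by have := mP x Px; rewrite gx maxxx mulr0.
- have : (m - f x) / g x <= sup U.
    apply: (ub_le_sup Uhas); right; exists x => //; split => //.
    by rewrite divfK // gt_eqF.
  by rewrite ler_pdivrMr //; lra.
suff : sup U <= (f x - m) / - g x by rewrite ler_pdivlMr; lra.
have ngx : 0 < - g x by rewrite oppr_gt0.
apply: ge_sup => // u [->|[y Py [gy uy]]].
  apply: divr_ge0; last exact: ltW.
  by have := mP x Px; rewrite (max_r (ltW gx)) addr0 subr_ge0.
rewrite ler_pdivlMr // -(ler_pM2r gy).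
have -> : u * - g x * g y = (u * g y) * - g x by ring.
by rewrite uy; have := mid y x Py Px gy gx; lra.
Qed.

(** Induction on [s]: the tail is linearised first, with the hinge of [i] absorbed in the convex
    part; the tail is then affine and the hinge of [i] can be linearised in turn. *)
Lemma sum_max0_minimax (T : eqType) (s : seq T) (f : E -> R) (g : T -> E -> R) :
  uniq s -> convex_fun f -> (forall i, affine_fun (g i)) ->
  exists2 om : T -> R, (forall i, 0 <= om i <= 1) &
    forall v, (forall x, P x -> v <= f x + \sum_(i <- s) Num.max (g i x) 0) ->
              forall x, P x -> v <= f x + \sum_(i <- s) om i * g i x.
Proof.
move=> + + gA; elim: s f => [|i s IH] f /= => [_|/andP[is_ us]] fC.
  by exists (fun=> 0) => [_|v vP x /vP]; rewrite ?lexx ?ler01 // !big_nil.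
have [om om01 omP] := IH _ us (convex_add fC (convex_pos_part (gA i))).
have sumC : convex_fun (fun x => \sum_(j <- s) om j * g j x).
  by apply/affine_convex/affine_fun_sum => j; apply: affine_fun_scale.
have [o o01 oP] := max0_minimax (convex_add fC sumC) (gA i).
exists (fun j => if j == i then o else om j) => [j|v vP x Px].
  by case: ifP.
rewrite big_cons eqxx.
have -> : \sum_(j <- s) (if j == i then o else om j) * g j x =
          \sum_(j <- s) om j * g j x.
  rewrite !big_seq; apply: eq_bigr => j js; case: eqP => // ji.
  by rewrite -ji js in is_.
rewrite addrCA addrC; apply: oP => // z Pz; rewrite addrAC; apply: omP => //.
by move=> w Pw; have := vP w Pw; rewrite big_cons addrA.
Qed.

End Minimax.

(** * Greedy choice under row and total budgets *)

(** Greedy: adjoin a maximiser of [f] among the elements left over; its value is the new threshold.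
    Once [A] is exhausted the threshold is [0], whence the complementary slackness in the last
    clause. *)
Lemma exists_top (R : realDomainType) (T : finType) (A : {set T}) (f : T -> R)
    (k : nat) : (forall x, 0 <= f x) ->
  exists (B : {set T}) (theta : R),
  [/\ B \subset A, (#|B| <= k)%N & 0 <= theta] /\
  [/\ forall x, x \in B -> theta <= f x,
      forall x, x \in A -> x \notin B -> f x <= theta
    & 0 < theta -> #|B| = k].
Proof.
move=> f0; elim: k => [|k [B [th [[BA Bk th0] [thB thA thk]]]]].
  (* For [k = 0] nothing is kept, so the threshold only has to dominate [f]; the sum of its
     nonnegative values does. *)
  exists set0, (\sum_x f x); rewrite sub0set cards0; split.
    by split=> //; apply: sumr_ge0.
  split=> // x; rewrite ?inE // => _ _.
  by rewrite (bigD1 x) //= lerDl; apply: sumr_ge0.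
have [AB|/subsetPn[x0 x0A x0B]] := boolP (A \subset B).
  exists B, 0; split; first by split=> //; apply: leqW.
  by split=> // [x /(subsetP AB) ->|]; rewrite ?ltxx.
have x0D : x0 \in A :\: B by rewrite inE x0A x0B.
case: (arg_maxP f x0D) => x /setDP[xA xB] xmax.
exists (x |: B), (f x); split; split=> //.
- by rewrite subUset sub1set xA.
- by rewrite cardsU1 xB.
- by move=> y /setU1P[->//|yB]; apply: le_trans (thB y yB); apply: thA.
- move=> y yA; rewrite in_setU1 negb_or => /andP[_ yB].
  by apply: xmax; apply/setDP.
- move=> fx; rewrite cardsU1 xB thk //.
  by apply: lt_le_trans fx _; apply: thA.
Qed.

(** Keep the [q] largest entries of each row, then the [Q] largest of those;
    [eta i + rho] is the larger of the two thresholds. *)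
Lemma budget_certificate (R : realDomainType) (m n : nat)
    (D : 'I_m * 'I_n -> R) (q Q : nat) : (forall p, 0 <= D p) ->
  exists (T : {set 'I_m * 'I_n}) (eta : 'I_m -> R) (rho : R),
  [/\ (#|T| <= Q)%N, forall i, (#|[set p in T | p.1 == i]| <= q)%N
    & forall p, p \in T -> 0 < D p] /\
  [/\ forall i, 0 <= eta i, 0 <= rho
    & \sum_(p in T) D p = \sum_p Num.max (D p - (eta p.1 + rho)) 0
        + q%:R * \sum_i eta i + Q%:R * rho].
Proof.
move=> D0.
have /fin_all_exists[B /fin_all_exists[th BP]] (i : 'I_m) :=
  exists_top [set p : 'I_m * 'I_n | p.1 == i] q D0.
pose K := [set p : 'I_m * 'I_n | p \in B p.1].
have [T [rho [[TK TQ rho0] [TD KD rhoQ]]]] := exists_top K Q D0.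
pose eta i := Num.max (th i - rho) 0.
have eta0 i : 0 <= eta i by rewrite le_max lexx orbT.
have in_row i p : p \in B i -> p.1 = i.
  by have [[/subsetP BA _ _] _] := BP i => /BA; rewrite inE => /eqP.
have TB p : p \in T -> p \in B p.1 by move=> /(subsetP TK); rewrite inE.
have T_row i : [set p in T | p.1 == i] \subset B i.
  by apply/subsetP => p; rewrite inE => /andP[/TB + /eqP <-].
have TgeE p : p \in T -> eta p.1 + rho <= D p.
  move=> pT; have [_ [thB _ _]] := BP p.1; rewrite -lerBrDr ge_max.
  by rewrite lerD2r thB ?TB // subr_ge0 TD.
have TleE p : p \notin T -> D p <= eta p.1 + rho.
  move=> pT; have [pB|pB] := boolP (p \in B p.1).
    by apply: le_trans (KD p _ pT) _; rewrite ?inE // lerDr.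
  have [_ [_ thA _]] := BP p.1.
  by rewrite -lerBlDr le_max lerD2r thA ?inE.
(* Complementary slackness: [eta i] is nonzero only if the row threshold exceeds [rho], and then the
   second selection keeps all [q] entries of row [i]. *)
have etaE i : #|[set p in T | p.1 == i]|%:R * eta i = q%:R * eta i.
  have [->|eta_neq0] := eqVneq (eta i) 0; first by rewrite !mulr0.
  have rho_th : rho < th i.
    rewrite ltNge; apply: contra eta_neq0 => le_th.
    by rewrite /eta max_r // subr_le0.
  have [_ [thB _ thq]] := BP i.
  congr (_%:R * _); rewrite -(thq (le_lt_trans rho0 rho_th)).
  congr #|pred_of_set _|.
  apply/eqP; rewrite eqEsubset T_row; apply/subsetP => p pB.
  have pi := in_row _ _ pB; rewrite inE pi eqxx andbT.
  apply: contraT => /KD; rewrite inE pi => /(_ pB).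
  by rewrite leNgt (lt_le_trans rho_th) // thB.
(* Entries with [D p = 0] are dropped to make the chosen ones strictly positive; the sum does not
   change. *)
pose T' := [set p in T | 0 < D p].
have T'T : T' \subset T by apply/subsetP => p; rewrite inE => /andP[].
exists T', eta, rho; split; split=> //.
- exact: leq_trans (subset_leq_card T'T) TQ.
- move=> i; have [[_ Bq _] _] := BP i; apply: leq_trans Bq.
  apply: leq_trans (subset_leq_card (T_row i)); apply/subset_leq_card/subsetP.
  by move=> p; rewrite !inE -andbA => /and3P[-> _ ->].
- by move=> p; rewrite inE => /andP[].
have -> : \sum_(p in T') D p = \sum_(p in T) D p.
  rewrite [RHS](bigID (fun p => 0 < D p)) /= [X in _ + X]big1 ?addr0 => [|p].
    by apply: eq_bigl => p; rewrite inE.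
  by case/andP=> _; rewrite lt0r D0 andbT negbK => /eqP.
have -> : \sum_p Num.max (D p - (eta p.1 + rho)) 0
    = \sum_(p in T) (D p - (eta p.1 + rho)).
  rewrite (bigID [in T]) /= [X in _ + X]big1 ?addr0 => [|p pT].
    by apply: eq_bigr => p pT; rewrite max_l // subr_ge0 TgeE.
  by rewrite max_r // subr_le0 TleE.
rewrite sumrB big_split /=.
have -> : \sum_(p in T) rho = Q%:R * rho.
  rewrite sumr_const -[LHS]mulr_natl.
  have [->|rho_neq0] := eqVneq rho 0; first by rewrite !mulr0.
  by rewrite rhoQ // lt0r rho_neq0.
have -> : \sum_(p in T) eta p.1 = q%:R * \sum_i eta i; last by ring.
rewrite mulr_sumr (partition_big fst predT) //=; apply: eq_bigr => i _.
rewrite -etaE (eq_bigr (fun=> eta i)) => [|p /andP[_ /eqP->] //].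
rewrite sumr_const mulr_natl; congr (_ *+ _).
by apply: eq_card => p; rewrite !inE.
Qed.

(** * Positive and negative parts, Frobenius pairing, entrywise norms *)

Lemma pos_negE (R : realDomainType) (x : R) : x = pos_part x - neg_part x.
Proof. by rewrite /pos_part /neg_part; case: (leP x 0) => _; ring. Qed.

Lemma pos_part_ge0 (R : realDomainType) (x : R) : 0 <= pos_part x.
Proof. by rewrite le_max lexx orbT. Qed.

Lemma neg_part_ge0 (R : realDomainType) (x : R) : 0 <= neg_part x.
Proof. by rewrite oppr_ge0 ge_min lexx orbT. Qed.

Lemma pos_part_gt0_neg (R : realDomainType) (x : R) :
  0 < pos_part x -> neg_part x = 0.
Proof.
by rewrite /pos_part /neg_part; case: (leP x 0) => x0; rewrite ?ltxx ?oppr0.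
Qed.

Lemma neg_part_gt0_pos (R : realDomainType) (x : R) :
  0 < neg_part x -> pos_part x = 0.
Proof.
by rewrite /pos_part /neg_part; case: (leP x 0) => x0; rewrite ?oppr0 ?ltxx.
Qed.

Section Frobenius.
Context (R : realType).

Definition frob m n (M M' : 'M[R]_(m, n)) : R := \sum_i \sum_j M i j * M' i j.

Lemma frobE m n (M M' : 'M[R]_(m, n)) : frob M M' = \tr (M^T *m M').
Proof.
rewrite /frob exchange_big; apply: eq_bigr => j _; rewrite mxE.
by apply: eq_bigr => i _; rewrite mxE.
Qed.

Lemma frobDr m n (M M1 M2 : 'M[R]_(m, n)) :
  frob M (M1 + M2) = frob M M1 + frob M M2.
Proof. by rewrite !frobE mulmxDr mxtraceD. Qed.

Lemma frobNl m n (M M' : 'M[R]_(m, n)) : frob (- M) M' = - frob M M'.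
Proof. by rewrite !frobE linearN /= mulNmx raddfN. Qed.

Lemma frob_adj m n p r (M : 'M[R]_(m, n)) (B : 'M_(m, p)) (H : 'M_(p, r))
    (V : 'M_(r, n)) : frob M (B *m H *m V) = frob (B^T *m M *m V^T) H.
Proof.
by rewrite !frobE !trmx_mul !trmxK !mulmxA mxtrace_mulC !mulmxA.
Qed.

Lemma frob_delta m n (M : 'M[R]_(m, n)) i j : frob (delta_mx i j) M = M i j.
Proof.
rewrite /frob (bigD1 i) //= (bigD1 j) //= mxE !eqxx mul1r.
rewrite !big1 ?addr0 // => [i' /negPf i'i|j' /negPf j'j].
  by rewrite big1 // => j' _; rewrite mxE i'i mul0r.
by rewrite mxE j'j andbF mul0r.
Qed.

End Frobenius.

Lemma norm1_norm0 (R : realDomainType) m n (M : 'M[R]_(m, n)) :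
  (forall i j, `|M i j| = (M i j != 0)%:R) -> norm1 M = (norm0 M)%:R.
Proof.
move=> ME; rewrite /norm1 /norm0 pair_big -sum1_card natr_sum [RHS]big_mkcond.
by apply: eq_bigr => -[i j] _; rewrite inE ME; case: (_ != 0).
Qed.

Lemma norm1_convex (R : realDomainType) m n (M M' : 'M[R]_(m, n)) (a b : R) :
  0 <= a -> 0 <= b -> norm1 (a *: M + b *: M') <= a * norm1 M + b * norm1 M'.
Proof.
move=> a0 b0; rewrite /norm1 !mulr_sumr -big_split; apply: ler_sum => i _.
rewrite /= !mulr_sumr -big_split; apply: ler_sum => j _ /=.
rewrite !mxE; apply: le_trans (ler_normD _ _) _.
by rewrite !normrM (ger0_norm a0) (ger0_norm b0).
Qed.

(** * Input perturbations *)

Section Input.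
Context (R : realType) (N : nat) (adj : rel 'I_N) (t : 'I_N).
Context (L : nat) (h : nat -> nat).
Context (X : 'M[R]_(N, h 1%N)) (Xbin : forall u d, X u d = 0 \/ X u d = 1).
Context (q Q : nat).
Local Notation Xd := (Xdot adj t L X).
Local Notation inputs := 'M[R]_(#|nodes adj t L 1%N|, h 1%N).
Implicit Types (Ph Xt : inputs) (eta : 'cV[R]_#|nodes adj t L 1%N|) (rho : R).

(** The one of [0 <= Xt n d] and [Xt n d <= 1] that reads [deviation <= 1] has
    multiplier [Psi], the one that reads [0 <= deviation] the reduced cost. *)
Definition lb_mult Ph eta rho n d : R :=
  (1 - Xd n d) * (neg_part (Ph n d)
                  + Num.max (eta n 0 + rho - Delta X Ph n d) 0)
  + Xd n d * Psi X Ph eta rho n d.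

Definition ub_mult Ph eta rho n d : R :=
  (1 - Xd n d) * Psi X Ph eta rho n d
  + Xd n d * (pos_part (Ph n d)
              + Num.max (eta n 0 + rho - Delta X Ph n d) 0).

Lemma Xd_bin n d : Xd n d = 0 \/ Xd n d = 1.
Proof. by rewrite mxE. Qed.

Lemma Psi_ge0 Ph eta rho n d : 0 <= Psi X Ph eta rho n d.
Proof. by rewrite mxE le_max lexx orbT. Qed.

Lemma lb_mult_ge0 Ph eta rho n d : 0 <= lb_mult Ph eta rho n d.
Proof.
rewrite /lb_mult; case: (Xd_bin n d) => ->; rewrite ?subr0 ?subrr !mul0r ?mul1r.
  by rewrite addr0 addr_ge0 ?neg_part_ge0 // le_max lexx orbT.
by rewrite add0r Psi_ge0.
Qed.

Lemma ub_mult_ge0 Ph eta rho n d : 0 <= ub_mult Ph eta rho n d.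
Proof.
rewrite /ub_mult; case: (Xd_bin n d) => ->; rewrite ?subr0 ?subrr !mul0r ?mul1r.
  by rewrite addr0 Psi_ge0.
by rewrite add0r addr_ge0 ?pos_part_ge0 // le_max lexx orbT.
Qed.

(** The terms of the dual objective carried by the input layer. *)
Definition input_bound Ph eta rho : R :=
  - frob Xd Ph - norm1 (Psi X Ph eta rho) - q%:R * \sum_n eta n 0 - Q%:R * rho.

(** An entrywise identity, polynomial once [Xd n d] is set to [0] or [1]. It holds for arbitrary
    [Xt], so that it can enter a Lagrangian identity for the whole program. *)
Lemma input_lagrangian Ph eta rho Xt :
  - frob Ph Xt = input_bound Ph eta rho
    + \sum_n \sum_d lb_mult Ph eta rho n d * Xt n d
    + \sum_n \sum_d ub_mult Ph eta rho n d * (1 - Xt n d)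
    + \sum_n eta n 0 * (q%:R - \sum_d deviation X Xt n d)
    + rho * (Q%:R - \sum_n \sum_d deviation X Xt n d).
Proof.
have entry n d : - (Ph n d * Xt n d) = - (Xd n d * Ph n d)
    - Psi X Ph eta rho n d + lb_mult Ph eta rho n d * Xt n d
    + ub_mult Ph eta rho n d * (1 - Xt n d)
    - eta n 0 * deviation X Xt n d - rho * deviation X Xt n d.
  rewrite /lb_mult /ub_mult /deviation.
  (* [max (x, 0) = x + max (- x, 0)] trades [Psi] for the reduced cost. *)
  have : Psi X Ph eta rho n d
         = Delta X Ph n d - (eta n 0 + rho)
           + Num.max (eta n 0 + rho - Delta X Ph n d) 0.
    rewrite mxE; case: leP => ?; case: leP => ?; lra.
  move=> ->; have -> : Delta X Ph n d = pos_part (Ph n d) * (1 - Xd n d)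
      + neg_part (Ph n d) * Xd n d by rewrite [LHS]mxE.
  move: (pos_negE (Ph n d)).
  move: (pos_part (Ph n d)) (neg_part (Ph n d)) => p m ->.
  by case: (Xd_bin n d) => ->; ring.
have sum2 F G : \sum_n \sum_d (F n d + G n d) =
    (\sum_n \sum_d F n d) + \sum_n \sum_d G n d :> R.
  by rewrite -big_split; apply: eq_bigr => n _; rewrite -big_split.
have sum2N F : \sum_n \sum_d - F n d = - \sum_n \sum_d F n d :> R.
  by rewrite -sumrN; apply: eq_bigr => n _; rewrite sumrN.
have -> : \sum_n eta n 0 * (q%:R - \sum_d deviation X Xt n d) =
    q%:R * (\sum_n eta n 0) - \sum_n \sum_d eta n 0 * deviation X Xt n d.
  rewrite mulr_sumr -sumrB; apply: eq_bigr => n _.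
  by rewrite mulrBr mulrC mulr_sumr.
have -> : rho * (Q%:R - \sum_n \sum_d deviation X Xt n d) =
    Q%:R * rho - \sum_n \sum_d rho * deviation X Xt n d.
  rewrite mulrBr mulrC mulr_sumr; congr (_ - _).
  by apply: eq_bigr => n _; rewrite mulr_sumr.
have normE : norm1 (Psi X Ph eta rho) = \sum_n \sum_d Psi X Ph eta rho n d.
  by apply: eq_bigr => n _; apply: eq_bigr => d _; rewrite ger0_norm ?Psi_ge0.
rewrite /input_bound normE /frob -sum2N.
under eq_bigr => n _ do under eq_bigr => d _ do rewrite entry.
rewrite !sum2 !sum2N; ring.
Qed.

Lemma binary_relaxed Xt :
  binary_perturbation X q Q Xt -> relaxed_perturbation X q Q Xt.
Proof.
move=> [Xt01 XtQ Xtq].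
have entry n d : `|(Xt - Xd) n d| = ((Xt - Xd) n d != 0)%:R.
  rewrite !mxE; case: (Xt01 n d) => ->; case: (Xbin (enum_val n) d) => ->.
  - by rewrite subrr normr0 eqxx.
  - by rewrite sub0r normrN normr1 oppr_eq0 oner_eq0.
  - by rewrite subr0 normr1 oner_eq0.
  - by rewrite subrr normr0 eqxx.
split=> [n d||n].
- by case: (Xt01 n d) => ->; rewrite ?lexx ler01.
- by rewrite norm1_norm0 // ler_nat.
- by rewrite norm1_norm0 ?ler_nat // => i j; rewrite mxE entry.
Qed.

Lemma relaxed_perturbation_convex :
  convex_dom (@relaxed_perturbation R N adj t L h X q Q).
Proof.
move=> x y a b [x01 xQ xq] [y01 yQ yq] a0 b0 ab.
have subE : a *: x + b *: y - Xd = a *: (x - Xd) + b *: (y - Xd).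
  by rewrite -[in LHS](scale1r Xd) -ab scalerDl !scalerBr opprD addrACA.
have bound (u v c : R) : u <= c -> v <= c -> a * u + b * v <= c.
  move=> uc vc; rewrite -[c]mul1r -ab mulrDl.
  by apply: lerD; apply: ler_wpM2l.
split=> [n d||n].
- rewrite !mxE; have /andP[x0 x1] := x01 n d; have /andP[y0 y1] := y01 n d.
  by rewrite bound // andbT addr_ge0 // mulr_ge0.
- by rewrite subE; apply: le_trans (norm1_convex _ _ a0 b0) _; apply: bound.
- rewrite subE linearD !linearZ /=.
  by apply: le_trans (norm1_convex _ _ a0 b0) _; apply: bound.
Qed.

(** In [input_lagrangian] every multiplier and every slack is nonnegative. *)
Lemma input_bound_le Ph eta rho Xt : relaxed_perturbation X q Q Xt ->
  (forall n, 0 <= eta n 0) -> 0 <= rho ->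
  input_bound Ph eta rho <= - frob Ph Xt.
Proof.
move=> [Xt01 XtQ Xtq] eta0 rho0; rewrite (input_lagrangian Ph eta rho).
have devE n d : deviation X Xt n d = `|(Xt - Xd) n d| by rewrite deviationE.
move: (input_bound _ _ _) => ib; rewrite -!addrA lerDl !addr_ge0 //.
- apply: sumr_ge0 => n _; apply: sumr_ge0 => d _.
  by rewrite mulr_ge0 ?lb_mult_ge0 //; case/andP: (Xt01 n d).
- apply: sumr_ge0 => n _; apply: sumr_ge0 => d _.
  by rewrite mulr_ge0 ?ub_mult_ge0 // subr_ge0; case/andP: (Xt01 n d).
- apply: sumr_ge0 => n _; rewrite mulr_ge0 // subr_ge0.
  apply: le_trans (Xtq n); rewrite /norm1 big_ord1; apply: ler_sum => d _.
  by rewrite mxE devE.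
- rewrite mulr_ge0 // subr_ge0; apply: le_trans XtQ; apply: ler_sum => n _.
  by apply: ler_sum => d _; rewrite devE.
Qed.

Lemma Delta_ge0 Ph n d : 0 <= Delta X Ph n d.
Proof.
rewrite !mxE; case: (Xbin (enum_val n) d) => ->;
  rewrite ?subr0 ?subrr !mulr0 ?mulr1.
  by rewrite addr0 pos_part_ge0.
by rewrite add0r neg_part_ge0.
Qed.

(** Flipping a bit with positive [Delta] lowers the functional by exactly [Delta];
    [budget_certificate] selects the flips, and its thresholds are the multipliers. *)
Lemma input_bound_attained Ph : exists Xt eta rho,
  [/\ binary_perturbation X q Q Xt, forall n, 0 <= eta n 0, 0 <= rho
    & - frob Ph Xt = input_bound Ph eta rho].
Proof.
have [T [eta [rho [[TQ Tq Tgt0] [eta0 rho0 sumT]]]]] :=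
  budget_certificate q Q (fun p => Delta_ge0 Ph p.1 p.2).
pose Xt : inputs := \matrix_(n, d)
  if (n, d) \in T then 1 - Xd n d else Xd n d.
have XtE n d : (Xt - Xd) n d != 0 -> (n, d) \in T.
  by rewrite !mxE; case: ifP => //; rewrite subrr eqxx.
exists Xt, (\col_n eta n), rho; split=> //.
- split=> [n d||n].
  + by rewrite !mxE; case: ifP => _; case: (Xbin (enum_val n) d) => ->;
      rewrite ?subr0 ?subrr; auto.
  + apply: leq_trans TQ; apply/subset_leq_card/subsetP => -[n d].
    by rewrite inE => /XtE.
  + apply: leq_trans (Tq n); rewrite /norm0.
    have inj : injective (fun p : 'I_1 * 'I_(h 1%N) => (n, p.2)).
      by move=> [i d] [i' d'] [->]; rewrite (ord1 i) (ord1 i').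
    rewrite -(card_imset _ inj); apply/subset_leq_card/subsetP => p.
    case/imsetP=> -[i d]; rewrite inE /= mxE => /XtE ndT ->.
    by rewrite inE ndT eqxx.
- by move=> n; rewrite mxE.
have entry n d : - (Ph n d * Xt n d) =
    - (Xd n d * Ph n d) - (if (n, d) \in T then Delta X Ph n d else 0).
  rewrite [Xt n d]mxE; case: ifP => [/Tgt0 /=|_]; last by rewrite subr0 mulrC.
  have -> : Delta X Ph n d = pos_part (Ph n d) * (1 - Xd n d)
      + neg_part (Ph n d) * Xd n d by rewrite [LHS]mxE.
  have := pos_negE (Ph n d); case: (Xd_bin n d) => -> PhE;
    rewrite ?subr0 ?subrr ?mulr0 ?mulr1 ?addr0 ?add0r => D0; move: PhE.
    by rewrite (pos_part_gt0_neg D0); lra.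
  by rewrite (neg_part_gt0_pos D0); lra.
have sumTE : \sum_(p in T) Delta X Ph p.1 p.2 =
    \sum_n \sum_d if (n, d) \in T then Delta X Ph n d else 0.
  by rewrite pair_big [LHS]big_mkcond; apply: eq_bigr => -[n d].
have normE : norm1 (Psi X Ph (\col_n eta n) rho)
    = \sum_p Num.max (Delta X Ph p.1 p.2 - (eta p.1 + rho)) 0.
  rewrite /norm1 pair_big; apply: eq_bigr => p _.
  by rewrite ger0_norm ?Psi_ge0 // !mxE.
rewrite /input_bound normE.
have -> : \sum_n (\col_n eta n) n 0 = \sum_n eta n.
  by apply: eq_bigr => n _; rewrite mxE.
suff -> : - frob Ph Xt = - frob Xd Ph - \sum_(p in T) Delta X Ph p.1 p.2.
  rewrite sumT; ring.
rewrite sumTE /frob -!sumrN -big_split; apply: eq_bigr => n _.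
by rewrite /= -!sumrN -big_split; apply: eq_bigr => d _; rewrite entry.
Qed.

(** The greedy binary point attains a bound that is valid for all relaxed perturbations. *)
Lemma frob_binary_le Ph Xt : relaxed_perturbation X q Q Xt ->
  exists2 Xt', binary_perturbation X q Q Xt' & frob Ph Xt <= frob Ph Xt'.
Proof.
move=> Xtr.
have [Xt' [eta [rho [Xt'b eta0 rho0 Xt'E]]]] := input_bound_attained Ph.
by exists Xt' => //; rewrite -lerN2 Xt'E; apply: input_bound_le.
Qed.

End Input.

(** * Relaxed layers *)

Section Layers.
Context (R : realType) (N : nat) (adj : rel 'I_N) (t : 'I_N).
Context (L : nat) (h : nat -> nat).
Context (A : nat -> 'M[R]_N).
Context (W : forall l : nat, 'M[R]_(h l, h l.+1)).
Context (b : forall l : nat, 'cV[R]_(h l.+1)).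
Context (X : 'M[R]_(N, h 1%N)) (Xbin : forall u d, X u d = 0 \/ X u d = 1).
Context (q Q : nat).
Local Notation layers := (layers R adj t L h).
Local Notation layer l := 'M[R]_(#|nodes adj t L l|, h l).
Local Notation Adot := (Adot adj t L A).
Local Notation bias := (bias_rows adj t L b).
Context (Rb Sb : layers).
Implicit Types (H Hh Phi Phih Omega : layers) (Xt : layer 1).
Local Notation relaxed := (@relaxed_perturbation R N adj t L h X q Q).

(** Each layer has its own matrix type, so the new value is transported along [l = k]; [eq_axiomK]
    makes the transport trivial at [l] itself. *)
Lemma layers_upd H l (M : layer l) :
  exists2 H' : layers, H' l = M & forall k, k != l -> H' k = H k.
Proof.
exists (fun k => match @eqP _ l k with
  | ReflectT e => ecast k 'M[R]_(#|nodes adj t L k|, h k) e M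
  | ReflectF _ => H k end).
- by case: eqP => [e|//]; rewrite eq_axiomK.
- by move=> k /eqP kl; case: eqP => // lk; case: kl.
Qed.

(** A concrete exact network lets [valid_bounds] be applied to any binary perturbation. The inner
    [match] takes the recursive value as an argument so that its type is refined along with [k]. *)
Fixpoint exact_H Xt l : layer l :=
  match l return layer l with
  | 0 => 0
  | k.+1 =>
    match k return layer k -> layer k.+1 with
    | 0 => fun=> Xt
    | k'.+1 => fun Hk =>
        map_mx (fun x => Num.max x 0) (Adot k'.+1 *m Hk *m W k'.+1 + bias k'.+1)
    end (exact_H Xt k)
  end.

Definition exact_Hh Xt l : layer l :=
  if l is k.+1 return layer l then Adot k *m exact_H Xt k *m W k + bias k
  else 0.

Lemma exact_networkP Xt : exact_network A W b Xt (exact_H Xt) (exact_Hh Xt).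
Proof. by split=> // -[|[|l]] // _ n j; rewrite /= mxE. Qed.

(** Once the index sets are fixed all constraints are affine; [u + v = 1] takes care of the bias and
    of [Rb]. *)
Lemma relaxed_upto_convex m H1 Hh1 H2 Hh2 Xt1 Xt2 (u v : R) :
  0 <= u -> 0 <= v -> u + v = 1 ->
  relaxed_upto A W b Rb Sb m Xt1 H1 Hh1 ->
  relaxed_upto A W b Rb Sb m Xt2 H2 Hh2 ->
  relaxed_upto A W b Rb Sb m (u *: Xt1 + v *: Xt2)
    (fun l => u *: H1 l + v *: H2 l) (fun l => u *: Hh1 l + v *: Hh2 l).
Proof.
move=> u0 v0 uv [in1 lin1 relu1] [in2 lin2 relu2]; split=> [|l lm|l lm n j].
- by rewrite in1 in2.
- rewrite /linear_step lin1 // lin2 // mulmxDr mulmxDl -!scalemxAr -!scalemxAl.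
  by rewrite -[in RHS](scale1r (bias l)) -uv scalerDl !scalerDr addrACA.
have [p1 m1 i1] := relu1 l lm n j; have [p2 m2 i2] := relu2 l lm n j.
rewrite !mxE; split=> hI.
- by rewrite p1 ?p2.
- by rewrite m1 ?m2 // !mulr0 addr0.
have [a1 b1 c1] := i1 hI; have [a2 b2 c2] := i2 hI; split.
- by apply: lerD; apply: ler_wpM2l.
- by apply: addr_ge0; apply: mulr_ge0.
rewrite [leRHS](_ : _ = u * (Sb l n j * (Hh1 l n j - Rb l n j))
  + v * (Sb l n j * (Hh2 l n j - Rb l n j))).
  by rewrite mulrDl -!mulrA; apply: lerD; apply: ler_wpM2l.
by rewrite -{1}[Rb l n j]mul1r -uv; ring.
Qed.

Lemma Iunst_bounds l n j :
  (n, j) \in Iunst Rb Sb l -> Rb l n j < 0 /\ 0 < Sb l n j.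
Proof. by rewrite inE /= => /andP. Qed.

Lemma Iunst_Iminus l n j : (n, j) \in Iunst Rb Sb l ->
  ((n, j) \in Iminus Rb Sb l) = false.
Proof.
by move=> /Iunst_bounds[r s]; rewrite inE /= (leNgt (Sb _ _ _)) s andbF.
Qed.

Lemma Iunst_Iplus l n j : (n, j) \in Iunst Rb Sb l ->
  ((n, j) \in Iplus Rb Sb l) = false.
Proof. by move=> /Iunst_bounds[r s]; rewrite !inE /= (leNgt 0) r !andbF. Qed.

Lemma Iplus_Iminus l n j : (n, j) \in Iplus Rb Sb l ->
  ((n, j) \in Iminus Rb Sb l) = false.
Proof. by rewrite in_setD => /andP[/negPf]. Qed.

Lemma activation_cover l n j : Rb l n j <= Sb l n j ->
  [|| (n, j) \in Iminus Rb Sb l, (n, j) \in Iplus Rb Sb l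
    | (n, j) \in Iunst Rb Sb l].
Proof.
move=> RS; rewrite in_setD; case: (_ \in Iminus _ _ _) / idP => //= /negP.
rewrite !inE /=; case: (leP (Sb l n j) 0) => [S0|S0 _].
  by rewrite (le_trans RS S0).
by rewrite (ltW S0) andbT /= andbT; case: leP.
Qed.

(** The set of admissible [H l n j] for [Hh l n j = x] is an interval; this is
    the endpoint that minimises [- a * H l n j]. *)
Definition best_activation l n j (a x : R) : R :=
  if (n, j) \in Iminus Rb Sb l then 0
  else if (n, j) \in Iplus Rb Sb l then x
  else if 0 <= a then Sb l n j * (x - Rb l n j) / (Sb l n j - Rb l n j)
  else Num.max x 0.

(** At an unstable neuron the chord lies above [0] iff [Rb <= x], and above [x] iff [x <= Sb]. *)
Lemma best_activation_relaxed l n j a x :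
  ((n, j) \in Iunst Rb Sb l -> Rb l n j <= x <= Sb l n j) ->
  let z := best_activation n j a x in
  [/\ (n, j) \in Iplus Rb Sb l -> z = x,
      (n, j) \in Iminus Rb Sb l -> z = 0
    & (n, j) \in Iunst Rb Sb l -> [/\ x <= z, 0 <= z
        & z * (Sb l n j - Rb l n j) <= Sb l n j * (x - Rb l n j)]].
Proof.
move=> xRS z; rewrite {}/z /best_activation; split=> hI.
- by rewrite Iplus_Iminus // hI.
- by rewrite hI.
rewrite Iunst_Iminus // Iunst_Iplus //; have [r s] := Iunst_bounds hI.
have /andP[rx xs] := xRS hI.
have d0 : 0 < Sb l n j - Rb l n j by lra.
have chord_ge0 : 0 <= Sb l n j * (x - Rb l n j).
  by rewrite mulr_ge0 ?subr_ge0 // ltW.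
have chord_gex : 0 <= Rb l n j * (x - Sb l n j).
  by rewrite mulr_le0 ?subr_le0 // ltW.
case: ifP => _; last first.
  by rewrite !le_max !lexx orbT; split=> //; case: (leP x 0) => x0; lra.
split; [rewrite ler_pdivlMr //; lra | apply: divr_ge0 => //; exact: ltW |].
by rewrite divfK // gt_eqF.
Qed.

(** One backward step of [dual_network] as a function. The last branch is that of [Iunst], since the
    three sets cover all entries when the bounds are ordered. *)
Definition relu_back l (Om Ph : layer l) : layer l := \matrix_(n, j)
  if (n, j) \in Iminus Rb Sb l then 0
  else if (n, j) \in Iplus Rb Sb l then Ph n j
  else Sb l n j / (Sb l n j - Rb l n j) * pos_part (Ph n j)
       - Om n j * neg_part (Ph n j).

Definition relu_const l (Ph : layer l) : R := \sum_(p in Iunst Rb Sb l)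
  Sb l p.1 p.2 * Rb l p.1 p.2 / (Sb l p.1 p.2 - Rb l p.1 p.2)
    * pos_part (Ph p.1 p.2).

(** [- a * best_activation n j a x] is the sum of the affine function
    [affine_cost] of [x] and of [max (hinge_cost, 0)]. *)
Definition affine_cost l (n : 'I_#|nodes adj t L l|) (j : 'I_(h l)) (a x : R)
    : R :=
  if (n, j) \in Iminus Rb Sb l then 0
  else if (n, j) \in Iplus Rb Sb l then - a * x
  else Sb l n j * Rb l n j / (Sb l n j - Rb l n j) * pos_part a
       - Sb l n j / (Sb l n j - Rb l n j) * pos_part a * x.

Definition hinge_cost l n j (a x : R) : R :=
  if (n, j) \in Iunst Rb Sb l then neg_part a * x else 0.

(** At an unstable neuron, a positive [a] selects the chord, whose cost is affine in [x]; for a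
    negative [a] the cost is [max (- a * x, 0)], the hinge. *)
Lemma best_activation_cost l n j a x : Rb l n j <= Sb l n j ->
  - (a * best_activation n j a x) =
  affine_cost n j a x + Num.max (hinge_cost n j a x) 0.
Proof.
rewrite /best_activation /affine_cost /hinge_cost => /activation_cover.
case: ifP => [hm _|_ /=].
  rewrite ifF ?maxxx ?mulr0 ?oppr0 ?addr0 //.
  by apply/negP => /Iunst_Iminus; rewrite hm.
case: ifP => [hp _|_ /= hI].
  rewrite ifF ?maxxx ?addr0 ?mulNr //.
  by apply/negP => /Iunst_Iplus; rewrite hp.
rewrite hI; have [r s] := Iunst_bounds hI.
have d0 : Sb l n j - Rb l n j != 0 by rewrite gt_eqF //; lra.
rewrite /pos_part /neg_part; case: (ltgtP a 0) => [a0|a0|->].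
- rewrite !(mulr0, mul0r) subr0 add0r.
  by case: (leP x 0) => x0; case: (leP (- a * x) 0) => ax; nra.
- by rewrite oppr0 mul0r maxxx addr0; field.
- by rewrite oppr0 !(mul0r, mulr0) maxxx subr0 addr0 oppr0.
Qed.

(** Compared with [best_activation_cost], each [max (hinge, 0)] has become [Om * hinge]: linearising
    the hinges yields the dual recursion. *)
Lemma relu_back_cost l (Om Ph x : layer l) :
  (forall n j, Rb l n j <= Sb l n j) ->
  - frob (relu_back Om Ph) x + relu_const Ph =
  \sum_(p : 'I_#|nodes adj t L l| * 'I_(h l))
    affine_cost p.1 p.2 (Ph p.1 p.2) (x p.1 p.2)
  + \sum_(p : 'I_#|nodes adj t L l| * 'I_(h l))
      Om p.1 p.2 * hinge_cost p.1 p.2 (Ph p.1 p.2) (x p.1 p.2).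
Proof.
move=> RS; rewrite /frob pair_big -sumrN /relu_const.
rewrite [X in _ + X = _]big_mkcond -!big_split; apply: eq_bigr => -[n j] _ /=.
rewrite mxE /affine_cost /hinge_cost; have := activation_cover (RS n j).
case: ifP => [hm _|_ /=].
  have -> : ((n, j) \in Iunst Rb Sb l) = false.
    by apply/negP => /Iunst_Iminus; rewrite hm.
  by ring.
case: ifP => [hp _|_ /= ->]; last by ring.
have -> : ((n, j) \in Iunst Rb Sb l) = false.
  by apply/negP => /Iunst_Iplus; rewrite hp.
by ring.
Qed.

Lemma affine_fun_hinge l (Ph : layer l) n j :
  affine_fun (fun x : layer l => hinge_cost n j (Ph n j) (x n j)).
Proof.
move=> x y u v uv; rewrite /hinge_cost.
case: ifP => _; last by rewrite !mulr0 addr0.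
by rewrite !mxE; ring.
Qed.

Lemma affine_fun_cost l (Ph : layer l) n j :
  affine_fun (fun x : layer l => affine_cost n j (Ph n j) (x n j)).
Proof.
move=> x y u v uv; rewrite /affine_cost !mxE.
case: ifP => _; first by rewrite !mulr0 addr0.
case: ifP => _; first by ring.
rewrite !mulrBr; set k := _ * pos_part _.
by rewrite -[k in LHS]mul1r -uv; ring.
Qed.

(** The dual objective cut off at layer [m]; for [m = L] it is [dual_obj], see [dual_objE]. *)
Definition partial_dual_obj m Phi Phih
    (eta : 'cV[R]_#|nodes adj t L 1%N|) (rho : R) : R :=
  \sum_(2 <= l < m) relu_const (Phih l)
  - \sum_(1 <= l < m) frob (Phi l.+1) (bias l)
  + input_bound X q Q (Phih 1%N) eta rho.

Hypothesis Rb_le_Sb :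
  forall l, (2 <= l < L)%N -> forall n j, Rb l n j <= Sb l n j.
Hypothesis relaxed_in_bounds : forall l, (2 <= l < L)%N ->
  forall Xt H Hh, relaxed Xt -> relaxed_upto A W b Rb Sb l Xt H Hh ->
  forall n j, (n, j) \in Iunst Rb Sb l -> Rb l n j <= Hh l n j <= Sb l n j.

(** Speaking of all lower bounds [v] instead of an infimum avoids a proof of boundedness. *)
Definition lower_bound m (Ph : layer m) (v : R) : Prop :=
  forall Xt H Hh, relaxed Xt -> relaxed_upto A W b Rb Sb m Xt H Hh ->
  v <= - frob Ph (Hh m).

(** Pulling a linear functional back through a relaxed ReLU layer is lossless:
    the neurons with a nonnegative coefficient sit on the chord, and for the
    others the minimax theorem provides the slopes [Om]. *)
Lemma lower_bound_back m (Phm : layer m.+1) : (2 <= m < L)%N ->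
  let Ph := (Adot m)^T *m Phm *m (W m)^T in
  exists2 Om : layer m, (forall n j, 0 <= Om n j <= 1) &
    forall v, lower_bound Phm v ->
      lower_bound (relu_back Om Ph) (v + frob Phm (bias m) - relu_const Ph).
Proof.
move=> mL Ph.
(* The reachable ReLU inputs of layer [m] are the convex domain of the minimax argument. *)
pose C (x : layer m) := exists Xt H Hh,
  [/\ relaxed Xt, relaxed_upto A W b Rb Sb m Xt H Hh & x = Hh m].
have Cconv : convex_dom C.
  move=> _ _ u v [Xt1 [H1 [Hh1 [r1 n1 ->]]]] [Xt2 [H2 [Hh2 [r2 n2 ->]]]].
  move=> u0 v0 uv.
  exists (u *: Xt1 + v *: Xt2), (fun l => u *: H1 l + v *: H2 l).
  exists (fun l => u *: Hh1 l + v *: Hh2 l); split=> //.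
    exact: relaxed_perturbation_convex.
  exact: relaxed_upto_convex.
pose idx : finType := ('I_#|nodes adj t L m| * 'I_(h m))%type.
pose f (x : layer m) :=
  \sum_(p : idx) affine_cost p.1 p.2 (Ph p.1 p.2) (x p.1 p.2).
pose g (p : idx) (x : layer m) := hinge_cost p.1 p.2 (Ph p.1 p.2) (x p.1 p.2).
have fC : convex_fun C f.
  by apply/affine_convex/affine_fun_sum => p; apply: affine_fun_cost.
have [om om01 omP] := sum_max0_minimax Cconv (index_enum_uniq idx) fC
  (fun p => affine_fun_hinge Ph p.1 p.2).
exists (\matrix_(n, j) om (n, j)) => [n j|v vP]; first by rewrite mxE.
move=> Xt H Hh Xtr net; rewrite lerBlDr relu_back_cost; last exact: Rb_le_Sb.
have -> : \sum_(p : idx) (\matrix_(n, j) om (n, j)) p.1 p.2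
      * hinge_cost p.1 p.2 (Ph p.1 p.2) (Hh m p.1 p.2)
    = \sum_(p : idx) om p * g p (Hh m).
  by apply: eq_bigr => -[n j] _; rewrite mxE.
apply: omP; last by exists Xt, H, Hh.
move=> _ {Xt H Hh Xtr net} [Xt [H [Hh [Xtr net ->]]]].
(* The network is extended by one layer: cost-minimal activations at layer [m], and [Hh m.+1]
   computed from them. *)
pose Hm : layer m := \matrix_(n, j) best_activation n j (Ph n j) (Hh m n j).
have [H' H'm H'E] := layers_upd H Hm.
have [Hh' Hh'm Hh'E] :=
  layers_upd Hh (l := m.+1) (Adot m *m Hm *m W m + bias m).
have net' : relaxed_upto A W b Rb Sb m.+1 Xt H' Hh'.
  case: (net) => in0 lin relu; split=> [|l|l].
  - by rewrite H'E // neq_ltn; case/andP: mL => ->.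
  - rewrite ltnS (leq_eqVlt l) => /andP[l1 /predU1P[->|lm]].
      by rewrite /linear_step Hh'm H'm.
    rewrite /linear_step H'E ?Hh'E ?neq_ltn ?ltnS ?lm //.
    by apply: lin; rewrite l1.
  - rewrite ltnS (leq_eqVlt l) => /andP[l2 /predU1P[->|lm]] n j.
      rewrite H'm Hh'E ?neq_ltn ?ltnSn // mxE.
      by apply: best_activation_relaxed; apply: relaxed_in_bounds net _ _.
    rewrite H'E ?Hh'E ?neq_ltn ?ltnS ?lm ?(ltnW lm) //.
    by apply: relu; rewrite l2.
have := vP _ _ _ Xtr net'; rewrite Hh'm frobDr frob_adj -/Ph opprD => vle.
have -> : f (Hh m) + \sum_(p : idx) Num.max (g p (Hh m)) 0 = - frob Ph Hm.
  rewrite /frob pair_big -sumrN -big_split; apply: eq_bigr => -[n j] _ /=.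
  by rewrite [Hm n j]mxE best_activation_cost //; apply: Rb_le_Sb.
by rewrite -lerBrDr.
Qed.

(** Induction on depth with an arbitrary functional [Phm] on top: [lower_bound_back] strips one ReLU
    layer, and at the bottom, where [Hh 2] is affine in the input, the greedy certificate is exact.
    The dual point is chosen before [v], so it dominates all lower bounds at once. *)
Lemma dual_chain m (Phm : layer m.+2) : (m.+2 <= L)%N ->
  exists Omega Phi Phih (eta : 'cV[R]_#|nodes adj t L 1%N|) (rho : R),
  [/\ Phi m.+2 = Phm,
      forall l, (2 <= l < m.+2)%N -> forall n j, 0 <= Omega l n j <= 1,
      forall n, 0 <= eta n 0
    & 0 <= rho] /\
  [/\ forall l, (1 <= l < m.+2)%N ->
        Phih l = (Adot l)^T *m Phi l.+1 *m (W l)^T,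
      forall l, (2 <= l < m.+2)%N -> Phi l = relu_back (Omega l) (Phih l)
    & forall v, lower_bound Phm v ->
        v <= partial_dual_obj m.+2 Phi Phih eta rho].
Proof.
elim: m Phm => [|m IH] Phm mL.
  pose Ph := (Adot 1)^T *m Phm *m (W 1%N)^T.
  have [Xt [eta [rho [Xtb eta0 rho0 XtE]]]] :=
    input_bound_attained (adj := adj) (t := t) (L := L) Xbin q Q Ph.
  have [Phi Phi2 _] := layers_upd (fun=> 0) Phm.
  have [Phih Phih1 _] := layers_upd (fun=> 0) (l := 1%N) Ph.
  exists (fun=> 0), Phi, Phih, eta, rho; split; split=> //.
  - by case=> [|[|l]].
  - by case=> [|[|l]] //; rewrite Phih1 Phi2.
  - by case=> [|[|l]].
  move=> v vP; rewrite /partial_dual_obj big_geq // big_nat1 add0r Phi2 Phih1.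
  rewrite -XtE.
  (* No ReLU occurs before [Hh 2], so the exact network satisfies the relaxed constraints up to
     there. *)
  have := vP _ (exact_H Xt) (exact_Hh Xt) (binary_relaxed Xbin Xtb).
  rewrite /= frobDr frob_adj opprD addrC; apply.
  by split=> // -[|[|l]].
have [Om Om01 OmP] := lower_bound_back Phm (m := m.+2) mL.
set Ph := _ *m _ in Om Om01 OmP.
have := IH (relu_back Om Ph) (ltnW mL).
move=> [Omega [Phi [Phih [eta [rho [[Phim Omega01 eta0 rho0]]]]]]].
move=> [PhihE PhiE bd].
have [Omega' Om'm Om'E] := layers_upd Omega Om.
have [Phi' Phi'm Phi'E] := layers_upd Phi Phm.
have [Phih' Phih'm Phih'E] := layers_upd Phih Ph.
exists Omega', Phi', Phih', eta, rho; split; split=> //.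
- move=> l; rewrite ltnS (leq_eqVlt l) => /andP[l2 /predU1P[->|lm]] n j.
    by rewrite Om'm.
  by rewrite Om'E ?neq_ltn ?lm // Omega01 // l2.
- move=> l; rewrite ltnS (leq_eqVlt l) => /andP[l2 /predU1P[->|lm]].
    by rewrite Phih'm Phi'm.
  have ln : l != m.+2 by rewrite neq_ltn lm.
  by rewrite Phih'E // Phi'E // PhihE // l2.
- move=> l; rewrite ltnS (leq_eqVlt l) => /andP[l2 /predU1P[->|lm]].
    by rewrite Om'm Phih'm Phi'E ?neq_ltn ?ltnSn.
  have ln : l != m.+2 by rewrite neq_ltn lm.
  rewrite Om'E // Phih'E // Phi'E ?PhiE ?l2 //.
  by rewrite neq_ltn ltnS ltnW.
move=> v vP; have := bd _ (OmP v vP).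
rewrite /partial_dual_obj !(big_nat_recr m.+2) //= Phi'm Phih'm.
rewrite !(Phih'E 1%N) //.
have -> : \sum_(2 <= l < m.+2) relu_const (Phih' l) =
    \sum_(2 <= l < m.+2) relu_const (Phih l).
  by apply: eq_big_nat => l /andP[_ lm]; rewrite Phih'E ?neq_ltn ?lm.
have -> : \sum_(1 <= l < m.+2) frob (Phi' l.+1) (bias l) =
    \sum_(1 <= l < m.+2) frob (Phi l.+1) (bias l).
  by apply: eq_big_nat => l /andP[_ lm]; rewrite Phi'E // eqSS neq_ltn lm.
lra.
Qed.

End Layers.

(** * Linear programming duality *)

Lemma lp_weak_duality (R : realDomainType) (P : lin_prog R) w x :
  lp_dual_attains P w -> lp_feasible x -> w <= lp_value (P := P) x.
Proof.
move=> [y [z [[y0 dualE] ->]]] [geP eqP].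
have -> : lp_value x = \sum_i y i * (\sum_v lp_geA i v * x v)
    + \sum_e z e * (\sum_v lp_eqA e v * x v).
  under eq_bigr do rewrite mulr_sumr.
  under [X in _ + X]eq_bigr do rewrite mulr_sumr.
  rewrite exchange_big [X in _ + X]exchange_big -big_split /=.
  apply: eq_bigr => v _; rewrite -dualE mulrDl !mulr_suml.
  by congr (_ + _); apply: eq_bigr => i _; rewrite mulrA.
apply: lerD; first by apply: ler_sum => i _; apply: ler_wpM2l.
by apply: ler_sum => e _; rewrite eqP.
Qed.

(** Evaluating the identity at a unit vector and subtracting its value at [0] gives a dual equation;
    its value at [0] gives the dual value. *)
Lemma lp_of_affine_dual_attains (R : realDomainType) (V I E : finType)
    (cost : (V -> R) -> R) (ge : I -> (V -> R) -> R) (eqn : E -> (V -> R) -> R)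
    (y : I -> R) (z : E -> R) (w : R) :
  (forall i, 0 <= y i) -> cost (fun=> 0) = 0 ->
  (forall x, cost x = w + \sum_i y i * ge i x + \sum_e z e * eqn e x) ->
  lp_dual_attains (lp_of_affine cost ge eqn) w.
Proof.
move=> y0 cost0 costE; exists y, z; split; first split=> // v.
  rewrite /= /coef !costE.
  under eq_bigr do rewrite mulrBr.
  under [X in _ + X]eq_bigr do rewrite mulrBr.
  by rewrite !sumrB; ring.
rewrite /lp_dual_value /=.
under eq_bigr do rewrite mulrN.
under [X in _ + X]eq_bigr do rewrite mulrN.
by have := costE (fun=> 0); rewrite cost0 !sumrN => H0; lra.
Qed.

(** * Lagrangian identity for the relaxed network *)

Section Lagrangian.
Context (R : realType) (N : nat) (adj : rel 'I_N) (t : 'I_N).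
Context (L : nat) (L_ge2 : (2 <= L)%N) (h : nat -> nat).
Context (A : nat -> 'M[R]_N).
Context (W : forall l : nat, 'M[R]_(h l, h l.+1)).
Context (b : forall l : nat, 'cV[R]_(h l.+1)).
Context (X : 'M[R]_(N, h 1%N)) (Xbin : forall u d, X u d = 0 \/ X u d = 1).
Context (q Q : nat).
Local Notation layers := (layers R adj t L h).
Local Notation layer l := 'M[R]_(#|nodes adj t L l|, h l).
Local Notation Adot := (Adot adj t L A).
Local Notation bias := (bias_rows adj t L b).
Context (Rb Sb : layers).
Context (c : 'cV[R]_(h L)).
Implicit Types (H Hh Phi Phih Omega : layers) (Xt : layer 1).
Implicit Types (eta : 'cV[R]_#|nodes adj t L 1%N|) (rho : R).
Local Notation output_row := (\matrix_(n, k) - c k 0 : layer L).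
Local Notation primal := (primal_lp (adj := adj) (t := t) A W b X q Q Rb Sb c).

Lemma big_pineq (F : pineq adj t L h -> R) : \sum_i F i =
  \sum_n \sum_d F (X_ge0 (n, d)) + \sum_n \sum_d F (X_le1 (n, d))
  + (\sum_n F (@RowBudget N adj t L h n) + F (@TotalBudget N adj t L h))
  + (\sum_r F (ReluGeInput r) + \sum_r F (ReluGe0 r)
     + \sum_r F (ReluLeChord r)).
Proof.
have bij : bijective (@pineq_decode N adj t L h).
  exists (@pineq_code N adj t L h); last exact: pineq_codeK.
  by move=> [[[]|[|[]]]|[[]|]].
rewrite (reindex _ (onW_bij _ bij)) !big_sumType /= !pair_big.
by congr (_ + _ + (_ + _) + _);
  [apply: eq_bigr => -[]..|rewrite (big_pred1 tt) // => -[]].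
Qed.

Lemma big_peqn (F : peqn adj t L h -> R) : \sum_e F e =
  \sum_n \sum_d F (InputEq (n, d)) + \sum_r F (LinearEq r)
  + (\sum_r F (ReluActive r) + \sum_r F (ReluInactive r)).
Proof.
have bij : bijective (@peqn_decode N adj t L h).
  exists (@peqn_code N adj t L h); last exact: peqn_codeK.
  by move=> [[]|[]].
rewrite (reindex _ (onW_bij _ bij)) !big_sumType /= !pair_big.
by congr (_ + _ + _); apply: eq_bigr => -[].
Qed.

Lemma big_relu_index (F : forall l, 'I_#|nodes adj t L l| -> 'I_(h l) -> R) :
  \sum_(r : relu_index adj t L h) F (tag r).+2 (tagged r).1 (tagged r).2
  = \sum_(2 <= l < L) \sum_n \sum_j F l n j.
Proof.
rewrite big_add1 big_add1 big_mkord.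
under [RHS]eq_bigr do rewrite pair_big.
by rewrite sig_big_dep.
Qed.

(** By [frob_adj], pairing [Phi l.+1] with the linear part of layer [l] is pairing [Phih l] with
    [H l], so the layers telescope. [H] and [Hh] are arbitrary; the residuals of the linear
    equations stay explicit. *)
Lemma network_telescope Phi Phih H Hh :
  (forall l, (1 <= l < L)%N -> Phih l = (Adot l)^T *m Phi l.+1 *m (W l)^T) ->
  - frob (Phi L) (Hh L) =
    - \sum_(1 <= l < L) frob (Phi l.+1)
        (Hh l.+1 - (Adot l *m H l *m W l + bias l))
    - \sum_(1 <= l < L) frob (Phi l.+1) (bias l)
    + \sum_(2 <= l < L) (frob (Phi l) (Hh l) - frob (Phih l) (H l))
    - frob (Phih 1%N) (H 1%N).
Proof.
move=> PhihE.
have step l : (1 <= l < L)%N ->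
    frob (Phi l.+1) (Hh l.+1 - (Adot l *m H l *m W l + bias l)) =
    frob (Phi l.+1) (Hh l.+1) - frob (Phih l) (H l) - frob (Phi l.+1) (bias l).
  move=> /PhihE ->; rewrite -frob_adj.
  rewrite -{2}[Hh l.+1](subrK (Adot l *m H l *m W l + bias l)).
  by rewrite [X in _ = X - _ - _]frobDr [X in _ = _ + X - _ - _]frobDr; ring.
rewrite (eq_big_nat _ _ step) !sumrB.
have -> : \sum_(1 <= l < L) frob (Phi l.+1) (Hh l.+1) =
    \sum_(2 <= l < L) frob (Phi l) (Hh l) + frob (Phi L) (Hh L).
  by rewrite -big_nat_recr // [RHS]big_add1.
rewrite [\sum_(1 <= l < L) frob (Phih l) (H l)]big_ltn //; ring.
Qed.

(** [Omega] splits the negative part of [Phih] between the two lower faces [H >= Hh] and [H >= 0] of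
    the relaxed ReLU; the positive part goes to the chord. Off [Iunst] the constraints read
    [0 >= 0], hence no case distinction. *)
Definition ineq_mult Omega Phih eta rho (i : pineq adj t L h) : R :=
  match i with
  | X_ge0 (n, d) => lb_mult X (Phih 1%N) eta rho n d
  | X_le1 (n, d) => ub_mult X (Phih 1%N) eta rho n d
  | RowBudget n => eta n 0
  | TotalBudget => rho
  | ReluGeInput (existT k (n, j)) =>
      Omega k.+2 n j * neg_part (Phih k.+2 n j)
  | ReluGe0 (existT k (n, j)) =>
      (1 - Omega k.+2 n j) * neg_part (Phih k.+2 n j)
  | ReluLeChord (existT k (n, j)) =>
      pos_part (Phih k.+2 n j) / (Sb k.+2 n j - Rb k.+2 n j)
  end.

Definition eqn_mult Phi Phih (e : peqn adj t L h) : R :=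
  match e with
  | InputEq (n, d) => - Phih 1%N n d
  | LinearEq (existT i (n, j)) => - Phi i.+2 n j
  | ReluActive (existT k (n, j)) => - Phih k.+2 n j
  | ReluInactive (existT k (n, j)) => - Phih k.+2 n j
  end.

(** On [Iunst] the constant of the chord slack cancels [relu_const], and the coefficients of [z] add
    up to the negative minus the positive part, that is [- Ph]. *)
Lemma relu_lagrangian_layer l (Om Ph x z : layer l) :
  (forall n j, Rb l n j <= Sb l n j) ->
  frob (relu_back Rb Sb Om Ph) x - frob Ph z = relu_const Rb Sb Ph
  + \sum_n \sum_j Om n j * neg_part (Ph n j) *
      (if (n, j) \in Iunst Rb Sb l then z n j - x n j else 0)
  + \sum_n \sum_j (1 - Om n j) * neg_part (Ph n j) *
      (if (n, j) \in Iunst Rb Sb l then z n j else 0)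
  + \sum_n \sum_j pos_part (Ph n j) / (Sb l n j - Rb l n j) *
      (if (n, j) \in Iunst Rb Sb l then
         Sb l n j * (x n j - Rb l n j) - z n j * (Sb l n j - Rb l n j) else 0)
  + \sum_n \sum_j - Ph n j *
      (if (n, j) \in Iplus Rb Sb l then z n j - x n j else 0)
  + \sum_n \sum_j - Ph n j * (if (n, j) \in Iminus Rb Sb l then z n j else 0).
Proof.
move=> RS; rewrite /frob !pair_big -sumrB /relu_const.
rewrite [X in _ = X + _ + _ + _ + _ + _]big_mkcond -!big_split.
apply: eq_bigr => -[n j] _ /=; rewrite mxE.
have := activation_cover (RS n j).
have [hI|hI] := boolP ((n, j) \in Iunst Rb Sb l).
  have [r s] := Iunst_bounds hI; have d0 : Sb l n j - Rb l n j != 0.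
    by rewrite gt_eqF //; lra.
  rewrite Iunst_Iminus // Iunst_Iplus // => _.
  move: (pos_negE (Ph n j)).
  by move: (pos_part (Ph n j)) (neg_part (Ph n j)) => p m ->; field.
have [hp|hp] := boolP ((n, j) \in Iplus Rb Sb l).
  by rewrite Iplus_Iminus // => _; ring.
by rewrite !orbF => ->; ring.
Qed.

Lemma objective_output Hh : objective c Hh = - frob output_row (Hh L).
Proof.
(* The ball of radius [0] is the target alone. *)
have one : #|nodes adj t L L| = 1%N by rewrite /nodes subnn cards1.
have uniq_row n : n = target_row adj t L.
  by apply/val_inj; have := ltn_ord n; have := ltn_ord (target_row adj t L);
    rewrite /= {2 4}one !ltnS !leqn0 => /eqP -> /eqP ->.
rewrite /objective mxE /frob (bigD1 (target_row adj t L)) //=.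
rewrite [X in _ = - (_ + X)]big1 => [|n].
  rewrite addr0 -sumrN; apply: eq_bigr => k _.
  by rewrite mxE mulNr opprK mulrC.
by rewrite (uniq_row n) eqxx.
Qed.

Lemma dual_objE Phi Phih eta rho :
  dual_obj b X q Q Rb Sb Phi Phih eta rho =
  partial_dual_obj b X q Q Rb Sb L Phi Phih eta rho.
Proof.
rewrite /dual_obj /partial_dual_obj /input_bound -frobE.
have -> : \sum_(1 <= l < L) (const_mx 1 *m Phi l.+1 *m b l : 'M_1) 0 0
    = \sum_(1 <= l < L) frob (Phi l.+1) (bias l).
  apply: eq_bigr => l _; rewrite mxE /frob exchange_big; apply: eq_bigr => j _.
  rewrite mxE mulr_suml; apply: eq_bigr => n _.
  by rewrite !mxE mul1r.
rewrite /relu_const; ring.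
Qed.

Section Dual.
Hypothesis Rb_le_Sb :
  forall l, (2 <= l < L)%N -> forall n j, Rb l n j <= Sb l n j.

(** The telescoping, ReLU and input identities add up to one Lagrangian identity, whose inequality
    multipliers are nonnegative by the ranges of [Omega], [eta] and [rho]. *)
Lemma dual_solution_attains Omega Phi Phih eta rho :
  (forall l, (2 <= l < L)%N -> forall n j, 0 <= Omega l n j <= 1) ->
  (forall n, 0 <= eta n 0) -> 0 <= rho ->
  Phi L = output_row ->
  (forall l, (1 <= l < L)%N -> Phih l = (Adot l)^T *m Phi l.+1 *m (W l)^T) ->
  (forall l, (2 <= l < L)%N -> Phi l = relu_back Rb Sb (Omega l) (Phih l)) ->
  lp_dual_attains primal (partial_dual_obj b X q Q Rb Sb L Phi Phih eta rho).
Proof.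
move=> Omega01 eta0 rho0 PhiL PhihE PhiE.
apply: (@lp_of_affine_dual_attains _ _ _ _ _ _ _
  (ineq_mult Omega Phih eta rho) (eqn_mult Phi Phih)).
- have hid (k : 'I_L.-2) : (2 <= k.+2 < L)%N by rewrite /= -!ltn_predRL.
  case=> [[n d]|[n d]|n||[k [n j]]|[k [n j]]|[k [n j]]] //=.
  + exact: lb_mult_ge0.
  + exact: ub_mult_ge0.
  + have /andP[om0 _] := Omega01 _ (hid k) n j.
    by rewrite mulr_ge0 ?neg_part_ge0.
  + have /andP[_ om1] := Omega01 _ (hid k) n j.
    by rewrite mulr_ge0 ?neg_part_ge0 ?subr_ge0.
  + by rewrite divr_ge0 ?pos_part_ge0 ?subr_ge0 ?Rb_le_Sb.
- rewrite -(primal_lp_value A W b X q Q Rb Sb c) /lp_value big1 // => v _.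
  by rewrite mulr0.
move=> x; rewrite objective_output -PhiL (network_telescope (H_of x) _ PhihE).
rewrite big_pineq big_peqn.
set Xt := Xt_of x; set H := H_of x; set Hh := Hh_of x.
have -> : \sum_r ineq_mult Omega Phih eta rho (ReluGeInput r)
      * pineq_fun X q Q Rb Sb (ReluGeInput r) x
    = \sum_(2 <= l < L) \sum_n \sum_j Omega l n j * neg_part (Phih l n j) *
      (if (n, j) \in Iunst Rb Sb l then H l n j - Hh l n j else 0).
  by rewrite -big_relu_index; apply: eq_bigr => -[k [n j]].
have -> : \sum_r ineq_mult Omega Phih eta rho (ReluGe0 r)
      * pineq_fun X q Q Rb Sb (ReluGe0 r) x
    = \sum_(2 <= l < L) \sum_n \sum_j
      (1 - Omega l n j) * neg_part (Phih l n j) *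
      (if (n, j) \in Iunst Rb Sb l then H l n j else 0).
  by rewrite -big_relu_index; apply: eq_bigr => -[k [n j]].
have -> : \sum_r ineq_mult Omega Phih eta rho (ReluLeChord r)
      * pineq_fun X q Q Rb Sb (ReluLeChord r) x
    = \sum_(2 <= l < L) \sum_n \sum_j
      pos_part (Phih l n j) / (Sb l n j - Rb l n j) *
      (if (n, j) \in Iunst Rb Sb l then
         Sb l n j * (Hh l n j - Rb l n j) - H l n j * (Sb l n j - Rb l n j)
       else 0).
  by rewrite -big_relu_index; apply: eq_bigr => -[k [n j]].
have -> : \sum_r eqn_mult Phi Phih (ReluActive r)
      * peqn_fun A W b Rb Sb (ReluActive r) x
    = \sum_(2 <= l < L) \sum_n \sum_j - Phih l n j *
      (if (n, j) \in Iplus Rb Sb l then H l n j - Hh l n j else 0).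
  by rewrite -big_relu_index; apply: eq_bigr => -[k [n j]].
have -> : \sum_r eqn_mult Phi Phih (ReluInactive r)
      * peqn_fun A W b Rb Sb (ReluInactive r) x
    = \sum_(2 <= l < L) \sum_n \sum_j - Phih l n j *
      (if (n, j) \in Iminus Rb Sb l then H l n j else 0).
  by rewrite -big_relu_index; apply: eq_bigr => -[k [n j]].
have -> : \sum_r eqn_mult Phi Phih (LinearEq r)
      * peqn_fun A W b Rb Sb (LinearEq r) x
    = - \sum_(1 <= l < L) frob (Phi l.+1)
        (Hh l.+1 - (Adot l *m H l *m W l + bias l)).
  rewrite -sumrN; under [RHS]eq_bigr => l _.
    rewrite -frobNl /frob; over.
  rewrite big_add1 big_mkord.
  under [RHS]eq_bigr do rewrite pair_big.
  rewrite sig_big_dep; apply: eq_bigr => -[i [n j]] _ /=.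
  by rewrite [in RHS]mxE.
have reluE l : (2 <= l < L)%N -> _ :=
  fun lL => relu_lagrangian_layer (Omega l) (Phih l) (Hh l) (H l) (Rb_le_Sb lL).
have -> : \sum_(2 <= l < L) (frob (Phi l) (Hh l) - frob (Phih l) (H l)) =
    \sum_(2 <= l < L) (frob (relu_back Rb Sb (Omega l) (Phih l)) (Hh l)
                       - frob (Phih l) (H l)).
  by apply: eq_big_nat => l lL; rewrite PhiE.
rewrite (eq_big_nat _ _ reluE) !big_split /=.
have -> : - frob (Phih 1%N) (H 1%N) = - frob (Phih 1%N) Xt
    + \sum_n \sum_d - Phih 1%N n d * (H 1%N n d - Xt n d).
  rewrite -!sumrN -big_split; apply: eq_bigr => n _ /=.
  rewrite -!sumrN -big_split; apply: eq_bigr => d _ /=; ring.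
rewrite (input_lagrangian Xbin q Q (Phih 1%N) eta rho Xt) /partial_dual_obj.
have -> : \sum_n \sum_d - Phih 1%N n d * (H 1%N n d - Xt n d) =
  \sum_n \sum_d eqn_mult Phi Phih (InputEq (n, d))
    * peqn_fun A W b Rb Sb (InputEq (n, d)) x by [].
rewrite /=; ring.
Qed.

Lemma dual_attains_lower_bound w : lp_dual_attains primal w ->
  lower_bound A W b X q Q Rb Sb output_row w.
Proof.
move=> wP Xt H Hh Xtr [in0 lin relu].
have [x [xXt xH xHh]] := primal_lp_surj Xt H Hh.
have feas : lp_feasible (P := primal) x.
  apply/primal_lp_feasible => //; rewrite xXt; split=> //; split=> [|l lL|l lL].
  - by rewrite xH.
  - have /andP[l1 lL'] := lL.
    by rewrite /linear_step xH // xHh ?ltnS ?l1 //; apply: lin.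
  - have /andP[l2 lL'] := lL => n j.
    rewrite xH ?(ltnW l2) // xHh ?l2 ?(ltnW lL') //.
    exact: relu.
have := lp_weak_duality wP feas.
by rewrite primal_lp_value objective_output xHh // L_ge2 leqnn.
Qed.

End Dual.

(** The unperturbed input is admissible, and its exact network lies between the bounds. *)
Lemma Rb_le_Sb_of_valid : valid_bounds A W b X q Q Rb Sb ->
  forall l, (2 <= l < L)%N -> forall n j, Rb l n j <= Sb l n j.
Proof.
move=> valid l lL n j; pose Xd := Xdot adj t L X.
have Xdb : binary_perturbation X q Q Xd.
  have z0 m k : norm0 (0 : 'M[R]_(m, k)) = 0%N.
    by apply/eqP; rewrite cards_eq0; apply/eqP/setP => p; rewrite !inE mxE eqxx.
  by split=> [u d||u]; rewrite ?subrr ?linear0 ?z0 // mxE.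
have /andP[] := valid _ _ _ Xdb (exact_networkP A W b Xd) l lL n j.
exact: le_trans.
Qed.

(** Only layer [2] needs an argument: its ReLU inputs are affine in the input, so their values under
    relaxed perturbations lie between values under binary ones. *)
Lemma relaxed_in_bounds_of_valid : valid_bounds A W b X q Q Rb Sb ->
  relaxation_within_bounds A W b X q Q Rb Sb ->
  forall l, (2 <= l < L)%N -> forall Xt H Hh, relaxed_perturbation X q Q Xt ->
  relaxed_upto A W b Rb Sb l Xt H Hh ->
  forall n j, (n, j) \in Iunst Rb Sb l -> Rb l n j <= Hh l n j <= Sb l n j.
Proof.
move=> valid within [|[|[|l]]] // lL Xt H Hh Xtr net n j hI; last first.
  by apply: within net _ _ hI.
have [in0 /(_ 1%N isT) lin _] := net.
(* Pairing with [delta_mx n j] reads off the entry, which turns it into a functional of the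
   input. *)
pose Ph := (Adot 1)^T *m delta_mx n j *m (W 1%N)^T.
have HhE Yt : (Adot 1 *m Yt *m W 1%N + bias 1) n j = frob Ph Yt + bias 1 n j.
  by rewrite mxE -(frob_delta (_ *m _ *m _)) frob_adj.
have vb Yt : binary_perturbation X q Q Yt ->
    Rb 2%N n j <= frob Ph Yt + bias 1 n j <= Sb 2%N n j.
  move=> Ytb; rewrite -HhE.
  exact: valid Ytb (exact_networkP A W b Yt) 2%N lL n j.
have [Yu Yub Yule] := frob_binary_le Xbin Ph Xtr.
have [Yl Ylb Ylle] := frob_binary_le Xbin (- Ph) Xtr.
rewrite lin in0 HhE; have /andP[_ ub] := vb _ Yub; have /andP[lb _] := vb _ Ylb.
by move: Ylle; rewrite !frobNl; lra.
Qed.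

End Lagrangian.

(** * Equality of the two dual optima *)

Theorem theorem4p3 (R : realType) (N : nat) (adj : rel 'I_N) (t : 'I_N)
  (L : nat) (hL : (2 <= L)%N) (h : nat -> nat)
  (A : nat -> 'M[R]_N)
  (hA : forall l, (1 <= l < L)%N ->
        forall u v, A l u v <> 0 -> v = u \/ adj u v)
  (W : forall l : nat, 'M[R]_(h l, h l.+1))
  (b : forall l : nat, 'cV[R]_(h l.+1))
  (X : 'M[R]_(N, h 1%N)) (hX : forall u d, X u d = 0 \/ X u d = 1)
  (q Q : nat)
  (Rb Sb : forall l : nat, 'M[R]_(#|nodes adj t L l|, h l))
  (hRS : valid_bounds A W b X q Q Rb Sb)
  (hrelax : relaxation_within_bounds A W b X q Q Rb Sb)
  (ystar y : 'I_(h L)) :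
  let c : 'cV[R]_(h L) := delta_mx ystar 0 - delta_mx y 0 in
  exists v : R,
    is_max (lp_dual_attains (primal_lp A W b X q Q Rb Sb c)) v /\
    is_max (dual_obj_attains A W b X q Q Rb Sb c) v.
Proof.
case: L hL h A hA W b X hX Rb Sb hRS hrelax ystar y => [|[|m]] // hL h A _ W b.
move=> X hX Rb Sb hRS hrelax ystar y c.
have RS := Rb_le_Sb_of_valid hX hRS.
have in_bounds := relaxed_in_bounds_of_valid hX hRS hrelax.
have := dual_chain hX RS in_bounds (\matrix_(n, k) - c k 0) (leqnn m.+2).
move=> [Omega [Phi [Phih [eta [rho [[PhiL Om01 eta0 rho0]]]]]]].
move=> [PhihE PhiE best].
have attained :=
  dual_solution_attains hL b hX q Q RS Om01 eta0 rho0 PhiL PhihE PhiE.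
(* The point from [dual_chain] is feasible for both problems, and its value dominates every lower
   bound of the relaxed network. *)
exists (partial_dual_obj b X q Q Rb Sb m.+2 Phi Phih eta rho).
split.
  by split=> // w wP; apply/best/(dual_attains_lower_bound hL hX wP).
split=> [|w].
  exists Omega, eta, rho; split=> //; exists Phi, Phih; rewrite dual_objE.
  split=> //; split=> // l lL n j; rewrite PhiE // mxE; split=> hI.
  - by rewrite hI.
  - by rewrite Iplus_Iminus // hI.
  - by rewrite Iunst_Iminus // Iunst_Iplus.
move=> [Om [et [rh [Om01' et0 rh0 [Ph [Phh [[PhL PhhE PhE] ->]]]]]]].
(* An arbitrary dual solution also gives a feasible point of the linear programming dual, hence a
   lower bound. *)
rewrite dual_objE; apply/best/(dual_attains_lower_bound hL hX).
apply: (dual_solution_attains hL b hX q Q RS Om01' et0 rh0 PhL PhhE) => l lL.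
apply/matrixP => n j; have [hm hp hu] := PhE l lL n j.
rewrite mxE; have := activation_cover (RS l lL n j).
case: ifP => [/hm //|_ /=]; case: ifP => [/hp //|_ /= /hu //].
Qed.
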